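(* Let $\mathcal{M}=T^{2n}$ be the $2n$-dimensional torus with the standard symplectic structure $\omega$. Then for every integer $k$ with $1<k<n$, the Euler-Lagrange cohomology group $H^{2k-1}_{\mathrm{EL}}(\mathcal{M},\omega)$ and the symplectically harmonic cohomology group $H^{2k-1}_{\mathrm{hr}}(\mathcal{M},\omega)$ are not isomorphic as real vector spaces.
   Context: For a $2n$-dimensional symplectic manifold $(\mathcal{M},\omega)$ let $\mathcal{X}(\mathcal{M})$ be the space of smooth vector fields, $i_X$ contraction with $X$, $\omega^k$ the $k$-fold wedge product of $\omega$, and $\Omega^k(\mathcal{M})$ the space of differential $k$-forms. Euler-Lagrange cohomology: for $1\le k\le n$ put $\mathcal{X}_{\mathrm{S}}^{2k-1}(\mathcal{M},\omega):=\{X\in\mathcal{X}(\mathcal{M}) : \mathcal{L}_X(\omega^k)=0\}$ and $\mathcal{X}_{\mathrm{H}}^{2k-1}(\mathcal{M},\omega):=\{X\in\mathcal{X}(\mathcal{M}) : -i_X(\omega^k)\text{ is exact}\}\subseteq \mathcal{X}_{\mathrm{S}}^{2k-1}(\mathcal{M},\omega)$; then $H^{2k-1}_{\mathrm{EL}}(\mathcal{M},\omega):=\mathcal{X}_{\mathrm{S}}^{2k-1}(\mathcal{M},\omega)/\mathcal{X}_{\mathrm{H}}^{2k-1}(\mathcal{M},\omega)$. Symplectically harmonic cohomology: let $\hat f:\Omega^k(\mathcal{M})\to\Omega^{k-2}(\mathcal{M})$ be given in Darboux coordinates ($\omega=\sum_i\mathrm{d}p_i\wedge\mathrm{d}q^i$)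 by $\hat f=\sum_i i_{\partial/\partial q^i}\,i_{\partial/\partial p_i}$ (contraction with the Poisson bivector), and let $\delta:=[\hat f,\mathrm{d}]=\hat f\mathrm{d}-\mathrm{d}\hat f:\Omega^k(\mathcal{M})\to\Omega^{k-1}(\mathcal{M})$ (this coincides with $(-1)^{k+1}*\mathrm{d}*$ for the symplectic star operator). A form $\alpha$ is symplectically harmonic if $\mathrm{d}\alpha=0=\delta\alpha$; $\Omega^k_{\mathrm{hr}}(\mathcal{M})$ is the space of symplectically harmonic $k$-forms, and $H^k_{\mathrm{hr}}(\mathcal{M},\omega):=\Omega^k_{\mathrm{hr}}(\mathcal{M})/(\mathrm{im}(\mathrm{d})\cap\Omega^k_{\mathrm{hr}}(\mathcal{M}))$. The standard symplectic structure on $T^{2n}=\mathbb{R}^{2n}/\mathbb{Z}^{2n}$ is the one induced by $\sum_{i=1}^n \mathrm{d}p_i\wedge\mathrm{d}q^i$. *)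

(* Defs.v *)
From HB Require Import structures.
From mathcomp Require Import all_boot all_order all_algebra.
From mathcomp Require Import perm generic_quotient ring_quotient.
From mathcomp Require Import all_classical all_reals all_analysis.

Set Implicit Arguments.
Unset Strict Implicit.
Unset Printing Implicit Defensive.

Import Order.TTheory GRing.Theory Num.Theory.
Import numFieldNormedType.Exports.

Local Open Scope classical_set_scope.
Local Open Scope quotient_scope.
Local Open Scope ring_scope.

Record subspace (K : pzRingType) (V : lmodType K) := Subspace {
  subspace_pred :> {pred V};
  subspace_closed : submod_closed subspace_pred }.

Section LinearQuotient.
Variables (K : pzRingType) (V : lmodType K) (S : subspace V).

Fact subspace_subsemimod : subsemimod_closed S.
Proof. exact: GRing.submod_closed_semi (subspace_closed S). Qed.

HB.instance Definition _ :=
  GRing.isSubmodClosed.Build K V (subspace_pred S) subspace_subsemimod.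

Record subspace_type :=
  SubspaceType { subspace_val : V; _ : subspace_val \in subspace_pred S }.
HB.instance Definition _ := [isSub for subspace_val].
HB.instance Definition _ := [Choice of subspace_type by <:].
HB.instance Definition _ := [SubChoice_isSubLmodule of subspace_type by <:].

Definition lquot := Quotient.quot (subspace_pred S).
HB.instance Definition _ := GRing.Zmodule.on lquot.

Definition lquot_pi (x : V) : lquot := \pi_lquot x.

Lemma lquot_piE x y : (lquot_pi x = lquot_pi y) <-> x - y \in subspace_pred S.
Proof. by split=> [/eqP|xyS]; [|apply/eqP]; rewrite -Quotient.idealrBE. Qed.

Definition lquot_scale (a : K) (x : lquot) : lquot := lquot_pi (a *: repr x).

Lemma lquot_piZ a x : lquot_pi (a *: x) = lquot_scale a (lquot_pi x).
Proof.
apply/lquot_piE; rewrite -scalerBr rpredZ //.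
by apply/lquot_piE; rewrite /lquot_pi reprK.
Qed.

Lemma lquot_ind (P : lquot -> Prop) : (forall x, P (lquot_pi x)) -> forall x, P x.
Proof. by move=> PP x; rewrite -[x]reprK; apply: PP. Qed.

Lemma lquot_piD x y : lquot_pi (x + y) = lquot_pi x + lquot_pi y.
Proof. exact: Quotient.pi_add. Qed.

Fact lquot_scaleA a b x :
  lquot_scale a (lquot_scale b x) = lquot_scale (a * b) x.
Proof. by elim/lquot_ind: x => x; rewrite -!lquot_piZ scalerA. Qed.

Fact lquot_scale1 : left_id 1 lquot_scale.
Proof. by elim/lquot_ind => x; rewrite -!lquot_piZ scale1r. Qed.

Fact lquot_scaleDr : right_distributive lquot_scale +%R.
Proof.
move=> a; elim/lquot_ind => x; elim/lquot_ind => y.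
by rewrite -lquot_piD -!lquot_piZ scalerDr lquot_piD.
Qed.

Fact lquot_scaleDl x : {morph lquot_scale^~ x : a b / a + b}.
Proof.
by move=> a b; elim/lquot_ind: x => x; rewrite -!lquot_piZ scalerDl lquot_piD.
Qed.

HB.instance Definition _ := GRing.Zmodule_isLmodule.Build K lquot
  lquot_scaleA lquot_scale1 lquot_scaleDr lquot_scaleDl.

End LinearQuotient.

(* The vector space A / (A `&` B), for subspaces A and B of the same space. *)
Section Subquotient.
Variables (K : pzRingType) (V : lmodType K) (A B : subspace V).

Definition subspace_in : {pred subspace_type A} :=
  fun x => subspace_val x \in subspace_pred B.

Fact subspace_in_closed : submod_closed subspace_in.
Proof.
have inE x : (x \in subspace_in) = (\val x \in subspace_pred B) by [].
split=> [|a x y]; rewrite !inE ?raddf0 ?rpred0 //.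
by move=> xB yB; rewrite linearP rpredD ?rpredZ.
Qed.

Definition subquotient := lquot (Subspace subspace_in_closed).
HB.instance Definition _ := GRing.Lmodule.on subquotient.
End Subquotient.

Definition lin_isomorphic (K : pzRingType) (V W : lmodType K) : Prop :=
  exists f : {linear V -> W}, bijective f.

Section Torus.
Variables (R : realType) (m : nat).

(* Congruence modulo Z^m, so that torus is R^m / Z^m. *)
Definition lattice_rel : rel 'rV[R]_m :=
  fun x y => [forall i, (x - y) 0 i \is a Num.int].

Fact lattice_rel_equiv : equiv_class_of lattice_rel.
Proof.
split=> [x|x y|y x z].
- by apply/forallP => i; rewrite subrr mxE rpred0.
- by apply/forallP/forallP => h i; rewrite -opprB mxE rpredN.
- move=> /forallP h1 /forallP h2; apply/forallP => i.
  have -> : x - z = (x - y) + (y - z) by rewrite addrA subrK.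
  by rewrite mxE rpredD.
Qed.
Canonical lattice_equiv := EquivRelPack lattice_rel_equiv.
Canonical lattice_encModRel := defaultEncModRel lattice_rel.

Definition torus := {eq_quot lattice_rel}.
HB.instance Definition _ : EqQuotient _ lattice_rel torus := EqQuotient.on torus.
HB.instance Definition _ := Choice.on torus.

(* The pull-back of f along the universal covering R^m -> R^m / Z^m. *)
Definition on_cover (T : Type) (f : torus -> T) : 'rV[R]_m -> T :=
  fun x => f (\pi_torus x).

(* The covering is a local diffeomorphism, so f is C^oo iff its pull-back is;
   a function on R^m is C^oo iff all its iterated directional derivatives (itself
   included) are differentiable, i.e., iff they all exist and are continuous. *)
Definition smooth (W : normedModType R) (f : torus -> W) : Prop :=
  forall (s : seq 'rV[R]_m) x,
    differentiable (foldr (fun v g => 'D_v g) (on_cover f) s) x.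

(* The tangent bundle of the torus is trivialized by the translation-invariant
   vector fields d/dx_j. *)
Definition vfield := torus -> 'rV[R]_m.
HB.instance Definition _ := GRing.Lmodule.on vfield.

(* Derivative of f along the vector field X. The choice of a point above p is
   irrelevant: on_cover f is Z^m-periodic, see on_cover_dder. *)
Definition dder (W : normedModType R) (X : vfield) (f : torus -> W) : torus -> W :=
  fun p => 'D_(X p) (on_cover f) (repr p).

Lemma on_cover_dder (W : normedModType R) (v : 'rV[R]_m) (f : torus -> W) :
  on_cover (dder (fun=> v) f) = 'D_v (on_cover f).
Proof.
apply/funext => x; rewrite /on_cover /dder /derive.
have fE y : f (\pi_torus (y + repr (\pi_torus x))) = f (\pi_torus (y + x)).
  have /eqP := reprK (\pi_torus x); rewrite piE /= => xL.
  congr f; apply/eqP; rewrite piE /=; move: xL; rewrite /lattice_rel.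
  have -> // : y + repr (\pi_torus x) - (y + x) = repr (\pi_torus x) - x.
  by rewrite opprD addrACA subrr add0r.
have f0 : f (\pi_torus (repr (\pi_torus x))) = f (\pi_torus x) by rewrite reprK.
apply: (congr1 (fun g : R -> W => lim (g @ 0^'))).
apply/funext => h.
exact: (congr2 (fun a b => h^-1 *: (a - b)) (fE (h *: v)) f0).
Qed.

Definition lie_bracket (X Y : vfield) : vfield := dder X Y - dder Y X.

(* At each point, a function of k tangent vectors, listed as the rows of a
   k x m matrix. The differential k-forms are those satisfying is_form, below. *)
Definition form (k : nat) := torus -> 'M[R]_(k, m) -> R.
HB.instance Definition _ k := GRing.Zmodule.on (form k).

Definition setrow k (i : 'I_k) (u : 'rV[R]_m) (v : 'M[R]_(k, m)) : 'M[R]_(k, m) :=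
  \matrix_(j < k) (if j == i then u else row j v).

Definition multilinear k (a : 'M[R]_(k, m) -> R) : Prop :=
  forall i c u w v,
    a (setrow i (c *: u + w) v) = c * a (setrow i u v) + a (setrow i w v).

Definition alternating k (a : 'M[R]_(k, m) -> R) : Prop :=
  forall i j v, i != j -> row i v = row j v -> a v = 0.

Record is_form k (a : form k) : Prop := IsForm {
  form_smooth : forall v, smooth (fun p => a p v);
  form_multilinear : forall p, multilinear (a p);
  form_alternating : forall p, alternating (a p) }.

(* (d a)(v_0,..,v_k) = \sum_i (-1)^i v_i(a(v_0,..,^v_i,..,v_k)); the v_i are
   extended as constant vector fields, so the bracket terms vanish. *)
Definition extd k (a : form k) : form k.+1 := fun p v =>
  \sum_(i < k.+1)
    (-1) ^+ i * dder (fun=> row i v) (fun q => a q (row' i v)) p.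

(* i_X a = a(X, ..), with i_X = 0 on 0-forms. *)
Definition contract (X : vfield) k : form k -> form k.-1 :=
  match k return form k -> form k.-1 with
  | 0 => fun=> 0
  | k'.+1 => fun a p (v : 'M[R]_(k', m)) => a p (col_mx (X p) v : 'M[R]_(1 + k', m))
  end.

(* The normalization for which (a /\ b)(u, v) = a(u) b(v) - a(v) b(u) on
   1-forms, as is consistent with extd. *)
Definition wedge k l (a : form k) (b : form l) : form (k + l) := fun p v =>
  (k`! * l`!)%:R^-1 * \sum_(s : 'S_(k + l))
    (-1) ^+ s * (a p (usubmx (row_perm s v)) * b p (dsubmx (row_perm s v))).

Fixpoint wpow (a : form 2) (k : nat) : form k.*2 :=
  match k return form k.*2 with
  | 0 => fun _ _ => 1
  | k'.+1 => wedge a (@wpow a k')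
  end.
Arguments wpow a k : clear implicits.

(* The derivation formula
     (L_X a)(Y_1,..,Y_k) = X(a(Y_1,..,Y_k)) - \sum_i a(Y_1,..,[X,Y_i],..,Y_k),
   evaluated at constant vector fields; this determines L_X a by tensoriality. *)
Definition lie_derivative (X : vfield) k (a : form k) : form k := fun p v =>
  dder X (fun q => a q v) p
  - \sum_(i < k) a p (setrow i (lie_bracket X (fun=> row i v) p) v).

(* a \in im(d); there are no nonzero exact 0-forms. *)
Definition exact_form k : form k -> Prop :=
  match k return form k -> Prop with
  | 0 => fun a => a = 0
  | k'.+1 => fun a => exists2 b : form k', is_form b & a = extd b
  end.

Definition dcoord (j : 'I_m) : form 1 := fun _ v => v 0 j.
Definition coordv (j : 'I_m) : vfield := fun=> delta_mx 0 j.

Lemma derive_lin (W : normedModType R) (f g : 'rV[R]_m -> W) c v :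
  (forall x, differentiable f x) -> (forall x, differentiable g x) ->
  'D_v (c *: f + g) = c *: 'D_v f + 'D_v g.
Proof.
move=> df dg; apply/funext => x.
have dcf : derivable (c *: f) x v by apply: derivableZ; exact: diff_derivable.
rewrite deriveD //; last exact: diff_derivable.
rewrite deriveZ //; exact: diff_derivable.
Qed.

Lemma smooth_lin (W : normedModType R) c (f g : torus -> W) :
  smooth f -> smooth g -> smooth (c *: f + g).
Proof.
move=> sf sg s.
have -> : foldr (fun v g => 'D_v g) (on_cover (c *: f + g)) s =
    c *: foldr (fun v g => 'D_v g) (on_cover f) s +
    foldr (fun v g => 'D_v g) (on_cover g) s.
  by elim: s => [//|v s /= ->]; apply: derive_lin.
by move=> x; apply: differentiableD => //; apply: differentiableZ.
Qed.

Lemma smooth_cst (W : normedModType R) (w : W) : smooth (fun=> w).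
Proof.
move=> s x.
suff [w' ->] : exists w' : W,
    foldr (fun v g => 'D_v g) (on_cover (fun=> w)) s = (fun=> w').
  exact: differentiable_cst.
elim: s {x} => [|v s /= [w' ->]]; first by exists w.
by exists 0; apply/funext => x; rewrite derive_cst.
Qed.

Lemma smooth_derivable (W : normedModType R) (f : torus -> W) x v :
  smooth f -> derivable (on_cover f) x v.
Proof. by move=> /(_ [::] x)/diff_derivable. Qed.

Lemma dder_lin (W : normedModType R) X c (f g : torus -> W) :
  smooth f -> smooth g -> dder X (c *: f + g) = c *: dder X f + dder X g.
Proof.
move=> sf sg; apply/funext => p.
exact: (congr1 (@^~ (repr p))
  (derive_lin c (X p) (fun x => sf [::] x) (fun x => sg [::] x))).
Qed.

Lemma dder_cst (W : normedModType R) X (w : W) : dder X (fun=> w) = 0.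
Proof. by apply/funext => p; exact: derive_cst. Qed.

Lemma is_form_lin k c (a b : form k) :
  is_form a -> is_form b -> is_form (c *: a + b).
Proof.
move=> [a1 a2 a3] [b1 b2 b3]; split.
- move=> v; rewrite [X in smooth X](_ : _ = c *: (fun p => a p v) + (fun p => b p v)) //.
  exact: smooth_lin.
- move=> p i e u w v; rewrite !fctE /= !(a2, b2).
  by rewrite !scalerDr !mulrDr !addrA; congr (_ + _); rewrite addrAC mulrCA.
- by move=> p i j v ij e; rewrite !fctE (a3 p i j) ?(b3 p i j) // scaler0 addr0.
Qed.

Lemma is_form0 k : is_form (0 : form k).
Proof.
split => [v|p i c u w v|//]; first exact: smooth_cst.
by rewrite -[LHS]/(0 : R) -[RHS]/(c * 0 + 0 : R) mulr0 addr0.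
Qed.

Lemma extd_lin k c (a b : form k) : is_form a -> is_form b ->
  extd (c *: a + b) = c *: extd a + extd b.
Proof.
move=> [a1 _ _] [b1 _ _]; apply/funext => p; apply/funext => v.
rewrite !fctE /extd scaler_sumr -big_split; apply: eq_bigr => i _ /=.
rewrite [X in dder _ X](_ : _ = c *: (fun p => a p (row' i v)) + (fun p => b p (row' i v))) //.
rewrite dder_lin; [|exact: a1|exact: b1].
by rewrite -[RHS]/(c * _ + _) [X in _ * X]/(c * _ + _) mulrDr mulrCA.
Qed.

Lemma extd0 k : extd (0 : form k) = 0.
Proof.
have /= := extd_lin (-1) (is_form0 k) (is_form0 k).
by rewrite scaler0 addr0 scaleN1r addNr.
Qed.

Lemma exact_form0 k : exact_form (0 : form k).
Proof. by case: k => //= k; exists 0; [exact: is_form0|rewrite extd0]. Qed.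

Lemma exact_form_lin k c (a b : form k) :
  exact_form a -> exact_form b -> exact_form (c *: a + b).
Proof.
case: k a b => /= [a b -> ->|k a b [a' fa ->] [b' fb ->]].
  by rewrite scaler0 addr0.
by exists (c *: a' + b'); [exact: is_form_lin|rewrite extd_lin].
Qed.

Lemma contract_lin X k c (a b : form k) :
  contract X (c *: a + b) = c *: contract X a + contract X b.
Proof. by case: k a b => //= a b; rewrite scaler0 addr0. Qed.

Lemma col_mx_setrow k (u : 'rV[R]_m) (v : 'M[R]_(k, m)) :
  (col_mx u v : 'M[R]_(1 + k, m)) = setrow (k := 1 + k) ord0 u (col_mx 0 v).
Proof.
apply/matrixP => i j; rewrite [RHS]mxE; case: (split_ordP i) => i' ->.
  by rewrite [i']ord1 col_mxEu; case: eqP => // -[]; apply/val_inj.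
by case: eqP => [/(congr1 val)|_] //; rewrite [RHS]mxE !col_mxEd.
Qed.

Lemma col_mx_setrowS k i (u w : 'rV[R]_m) (v : 'M[R]_(k, m)) :
  (col_mx u (setrow i w v) : 'M[R]_(1 + k, m)) =
  setrow (k := 1 + k) (rshift 1 i) w (col_mx u v).
Proof.
apply/matrixP => i1 j; rewrite [RHS]mxE; case: (split_ordP i1) => i' ->.
  rewrite col_mxEu; case: eqP => [/(congr1 val) /= i'E|_].
    by have := ltn_ord i'; rewrite i'E.
  by rewrite [RHS]mxE col_mxEu.
rewrite col_mxEd [LHS]mxE (inj_eq (@rshift_inj _ _)).
by case: eqP => // _; rewrite [RHS]mxE [LHS]mxE col_mxEd.
Qed.

Lemma contract_form (u : 'rV[R]_m) k (a : form k) :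
  is_form a -> is_form (contract (fun=> u) a).
Proof.
case: k a => [a _|k a [a1 a2 a3]] /=; first exact: is_form0.
split=> [v|p i c u' w v|p i j v ij e]; first exact: a1.
  by rewrite !col_mx_setrowS a2.
apply: (a3 p (rshift 1 i) (rshift 1 j)); first by apply: contra_neq ij => /(@rshift_inj 1 k) ->.
by rewrite [LHS](rowKd i u v) [RHS](rowKd j u v).
Qed.

Lemma contract_vlin X Y c k (a : form k) : (forall p, multilinear (a p)) ->
  contract (c *: X + Y) a = c *: contract X a + contract Y a.
Proof.
case: k a => [a _|k a a2] /=; first by rewrite scaler0 addr0.
apply/funext => p; apply/funext => v; rewrite !fctE.
by rewrite col_mx_setrow a2 -!col_mx_setrow.
Qed.

Lemma setrow_perm k (s : 'S_k) i u (v : 'M[R]_(k, m)) :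
  row_perm s (setrow i u v) = setrow ((s^-1)%g i) u (row_perm s v).
Proof.
apply/matrixP => i1 j; rewrite !mxE -(can2_eq (permK s) (permKV s)).
by case: eqP => // _; rewrite !mxE.
Qed.

Lemma usub_setrowl k l (i : 'I_k) u (v : 'M[R]_(k + l, m)) :
  usubmx (setrow (lshift l i) u v) = setrow i u (usubmx v).
Proof.
apply/matrixP => i1 j; rewrite !mxE (inj_eq (@lshift_inj _ _)).
by case: eqP => // _; rewrite !mxE.
Qed.

Lemma usub_setrowr k l (i : 'I_l) u (v : 'M[R]_(k + l, m)) :
  usubmx (setrow (rshift k i) u v) = usubmx v.
Proof. by apply/matrixP => i1 j; rewrite !mxE eq_lrshift mxE. Qed.

Lemma dsub_setrowr k l (i : 'I_l) u (v : 'M[R]_(k + l, m)) :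
  dsubmx (setrow (rshift k i) u v) = setrow i u (dsubmx v).
Proof.
apply/matrixP => i1 j; rewrite !mxE (inj_eq (@rshift_inj _ _)).
by case: eqP => // _; rewrite !mxE.
Qed.

Lemma dsub_setrowl k l (i : 'I_k) u (v : 'M[R]_(k + l, m)) :
  dsubmx (setrow (lshift l i) u v) = dsubmx v.
Proof. by apply/matrixP => i1 j; rewrite !mxE eq_rlshift mxE. Qed.

Lemma wedge_multilinear k l (a : form k) (b : form l) p :
  multilinear (a p) -> multilinear (b p) -> multilinear (wedge a b p).
Proof.
move=> a2 b2 i c u w v; rewrite /wedge mulrCA -mulrDr; congr (_ * _).
rewrite mulr_sumr -big_split; apply: eq_bigr => s _ /=.
rewrite [X in _ = X + _]mulrCA -mulrDr; congr (_ * _); rewrite !setrow_perm.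
case: (split_ordP ((s^-1)%g i)) => j ->.
  by rewrite !usub_setrowl !dsub_setrowl a2 mulrDl mulrA.
by rewrite !usub_setrowr !dsub_setrowr b2 mulrDr mulrCA.
Qed.

Lemma wpow_multilinear (a : form 2) k p :
  multilinear (a p) -> multilinear (wpow a k p).
Proof.
move=> a2; elim: k => [[m0 lt_m0]|k IH]; first by have := lt_m0.
exact: (wedge_multilinear (k := 2) (l := k.*2) a2 IH).
Qed.

Lemma wpow_cst (a : form 2) k :
  (forall p q, a p = a q) -> forall p q, wpow a k p = wpow a k q.
Proof.
move=> aC p q; elim: k => [//|k IH] /=.
by apply/funext => v; rewrite /wedge (aC p q) IH.
Qed.

Lemma lie_derivative_lin c X Y k (a : form k) :
  smooth X -> smooth Y ->
  (forall p, multilinear (a p)) -> (forall p q, a p = a q) ->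
  lie_derivative (c *: X + Y) a
  = c *: lie_derivative X a + lie_derivative Y a.
Proof.
move=> sX sY a2 aC; apply/funext => p; apply/funext => v.
rewrite -[RHS]/(c * lie_derivative X a p v + lie_derivative Y a p v).
have d0 Z : dder Z (fun q => a q v) p = 0.
  rewrite (_ : (fun q => a q v) = (fun=> a p v)) ?dder_cst //.
  by apply/funext => q; rewrite (aC q p).
pose S Z := \sum_(i < k) a p (setrow i (lie_bracket Z (fun=> row i v) p) v).
have eL Z : lie_derivative Z a p v = - S Z.
  exact: etrans (congr1 (fun t => t - S Z) (d0 Z)) (sub0r _).
rewrite !eL mulrN -opprD; congr (- _).
rewrite /S mulr_sumr -big_split; apply: eq_bigr => i _ /=; rewrite -a2.
congr (a p (setrow i _ v)).
have eB Z : lie_bracket Z (fun=> row i v) p = - dder (fun=> row i v) Z p.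
  by rewrite /lie_bracket dder_cst sub0r.
rewrite !eB scalerN -opprD; congr (- _).
exact: (congr1 (@^~ p) (dder_lin (fun=> row i v) c sX sY)).
Qed.

End Torus.
Arguments wpow {R m} a k _ _.
Arguments dcoord {R m} j _ _.
Arguments coordv {R m} j _.

Section SymplecticTorus.
Variables (R : realType) (n : nat).

Local Notation p_ i := (lshift n i).
Local Notation q_ i := (rshift n i).

(* The coordinates are p_1,..,p_n,q_1,..,q_n, with symplectic form
   \sum_i dp_i /\ dq_i. *)
Definition omega : form R (n + n) 2 :=
  \sum_(i < n) wedge (dcoord (p_ i)) (dcoord (q_ i)).

Definition fhat k (a : form R (n + n) k) : form R (n + n) k.-2 :=
  \sum_(i < n) contract (coordv (q_ i)) (contract (coordv (p_ i)) a).

(* [fhat, d] = fhat d - d fhat; on 0- and 1-forms fhat vanishes, and with it the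
   second term, whose degree k.-2.+1 then differs from k.-1. *)
Definition codiff k : form R (n + n) k -> form R (n + n) k.-1 :=
  match k return form R (n + n) k -> form R (n + n) k.-1 with
  | 0 => fun a => fhat (extd a)
  | 1 => fun a => fhat (extd a)
  | _.+2 => fun a => fhat (extd a) - extd (fhat a)
  end.

Lemma dcoord_multilinear m (j : 'I_m) p : multilinear (dcoord (R := R) j p).
Proof.
move=> i c u w v; rewrite /dcoord !mxE [i]ord1 eqxx.
by rewrite -[u 0 j]/(u 0 j) !mxE.
Qed.

Lemma omegaP : (forall p, multilinear (omega p)) /\ (forall p q, omega p = omega q).
Proof.
rewrite /omega; elim/big_ind: _ => [|a b [a1 a2] [b1 b2]|j _].
- by split=> // p i c u w v; rewrite -[LHS]/(0 : R) -[RHS]/(c * 0 + 0 : R) mulr0 addr0.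
- split=> [p i c u w v|p q]; last by rewrite !fctE (a2 p q) (b2 p q).
  rewrite -[RHS]/(c * (a p (setrow i u v) + b p (setrow i u v))
    + (a p (setrow i w v) + b p (setrow i w v))).
  by rewrite -[LHS]/(a p _ + b p _) a1 b1 mulrDr addrACA.
- split=> // p; apply: (wedge_multilinear (k := 1) (l := 1));
  exact: dcoord_multilinear.
Qed.

Lemma fhat_lin k c (a b : form R (n + n) k) :
  fhat (c *: a + b) = c *: fhat a + fhat b.
Proof.
rewrite /fhat scaler_sumr -big_split; apply: eq_bigr => i _ /=.
by rewrite !contract_lin.
Qed.

Lemma is_formD m k (a b : form R m k) : is_form a -> is_form b -> is_form (a + b).
Proof. by move=> fa fb; rewrite -[a]scale1r; apply: is_form_lin. Qed.

Lemma fhat_form k (a : form R (n + n) k) : is_form a -> is_form (fhat a).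
Proof.
move=> fa; rewrite /fhat; elim/big_ind: _ => [|? ?|i _].
- exact: is_form0.
- exact: is_formD.
- by do 2!apply: contract_form.
Qed.

Lemma codiff_lin k c (a b : form R (n + n) k) : is_form a -> is_form b ->
  codiff (c *: a + b) = c *: codiff a + codiff b.
Proof.
have ed j (x y : form R (n + n) j) : is_form x -> is_form y ->
    fhat (extd (c *: x + y)) = c *: fhat (extd x) + fhat (extd y).
  by move=> fx fy; rewrite (extd_lin c fx fy) fhat_lin.
case: k a b => [|[|k]] a b fa fb; [exact: ed|exact: ed|rewrite /codiff ed //].
rewrite (fhat_lin c a b) (extd_lin c (fhat_form fa) (fhat_form fb)).
by rewrite opprD addrACA -scalerBr.
Qed.

Section EulerLagrange.
Variable k : nat.

Definition symplectic_pred : {pred vfield R (n + n)} :=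
  fun X => `[< smooth X /\ lie_derivative X (wpow omega k) = 0 >].

(* By Cartan's formula these fields satisfy symplectic_pred, so that
   X_S / (X_S `&` X_H) is X_S / X_H. *)
Definition hamiltonian_pred : {pred vfield R (n + n)} :=
  fun X => `[< smooth X /\ exact_form (- contract X (wpow omega k)) >].

Lemma lie_omega_lin c X Y : smooth X -> smooth Y ->
  lie_derivative (c *: X + Y) (wpow omega k) =
  c *: lie_derivative X (wpow omega k) + lie_derivative Y (wpow omega k).
Proof.
have [ml_omega cst_omega] := omegaP.
by move=> sX sY; apply: lie_derivative_lin => // p; [exact: wpow_multilinear|exact: wpow_cst].
Qed.

Lemma lie_omega0 : lie_derivative 0 (wpow omega k) = 0.
Proof.
have s0 : smooth (0 : vfield R (n + n)) by exact: smooth_cst.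
have := lie_omega_lin (-1) s0 s0; rewrite scaler0 addr0 => ->.
by rewrite scaleN1r addNr.
Qed.

Fact symplectic_closed : submod_closed symplectic_pred.
Proof.
split=> [|c X Y].
  apply/asboolP; split; first exact: smooth_cst.
  by rewrite lie_omega0.
move=> /asboolP[sX LX] /asboolP[sY LY]; apply/asboolP; split.
  exact: smooth_lin.
by rewrite lie_omega_lin // LX LY scaler0 addr0.
Qed.

Fact hamiltonian_closed : submod_closed hamiltonian_pred.
Proof.
have contract_cXY c X Y : - contract (c *: X + Y) (wpow omega k) =
    c *: (- contract X (wpow omega k)) + - contract Y (wpow omega k).
  rewrite contract_vlin ?scalerN ?opprD // => p.
  by apply: wpow_multilinear; case: omegaP.
split=> [|c X Y].
  apply/asboolP; split; first exact: smooth_cst.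
  have := contract_cXY (-1) 0 0; rewrite scaler0 addr0 scaleN1r opprK addrN => ->.
  exact: exact_form0.
move=> /asboolP[sX eX] /asboolP[sY eY]; apply/asboolP; split.
  exact: smooth_lin.
by rewrite contract_cXY; apply: exact_form_lin.
Qed.

Definition X_S := Subspace symplectic_closed.
Definition X_H := Subspace hamiltonian_closed.

(* H_EL k lives in degree 2k - 1; H_hr, below, is indexed by the degree itself. *)
Definition H_EL : lmodType R := subquotient X_S X_H.
End EulerLagrange.

Section Harmonic.
Variable k : nat.

Definition harmonic_pred : {pred form R (n + n) k} :=
  fun a => `[< [/\ is_form a, extd a = 0 & codiff a = 0] >].

Definition exact_pred : {pred form R (n + n) k} := fun a => `[< exact_form a >].

Fact harmonic_closed : submod_closed harmonic_pred.
Proof.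
split=> [|c a b].
  apply/asboolP; split; [exact: is_form0|exact: extd0|].
  have := codiff_lin (-1) (is_form0 R (n + n) k) (is_form0 _ _ k).
  by rewrite scaler0 addr0 scaleN1r addNr.
move=> /asboolP[fa da ca] /asboolP[fb db cb]; apply/asboolP; split.
- exact: is_form_lin.
- by rewrite extd_lin // da db scaler0 addr0.
- by rewrite codiff_lin // ca cb scaler0 addr0.
Qed.

Fact exact_closed : submod_closed exact_pred.
Proof.
split=> [|c a b]; first by apply/asboolP; exact: exact_form0.
by move=> /asboolP ea /asboolP eb; apply/asboolP; exact: exact_form_lin.
Qed.

Definition harmonic_forms := Subspace harmonic_closed.
Definition exact_forms := Subspace exact_closed.

Definition H_hr : lmodType R := subquotient harmonic_forms exact_forms.
End Harmonic.
End SymplecticTorus.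

(* Main.v *)
From HB Require Import structures.
Require Import Defs.
From mathcomp Require Import all_boot all_order all_algebra.
From mathcomp Require Import reals.
From mathcomp Require Import perm generic_quotient ring_quotient.
From mathcomp Require Import all_classical all_reals all_analysis.
From mathcomp Require Import ring zify.

Set Implicit Arguments.
Unset Strict Implicit.
Unset Printing Implicit Defensive.

(* Both spaces are compared through constant-coefficient objects: the Euler-Lagrange
   cohomology turns out to be too small, the harmonic one too large.

   Put a = i_X omega. The condition L_X (omega^k) = 0 says that da /\ omega^(k-1) = 0;
   evaluating this 2k-form on Darboux vectors shows da = 0, because k < n. On the
   universal cover a has a primitive F, whose increments along Z^(2n) are given by a
   linear form; subtracting that form amounts to subtracting a constant field xi
   from X and leaves a function f on the torus with i_(X - xi) omega = df. Then
   i_(X - xi) omega^k = k df /\ omega^(k-1) = d(k f omega^(k-1)) is exact, so the 2n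
   classes of constant fields span the Euler-Lagrange cohomology.

   Constant forms are harmonic. A constant exact form vanishes, because its
   coefficients are sums of derivatives of periodic functions, which have mean zero.
   Hence the classes of the C(2n, 2k-1) monomials dx_S are linearly independent, and
   C(2n, 2k-1) > 2n as 3 <= 2k-1 <= 2n-3. *)

Import Defs Order.TTheory GRing.Theory Num.Theory.
Import numFieldNormedType.Exports.

Local Open Scope classical_set_scope.
Local Open Scope quotient_scope.
Local Open Scope ring_scope.

(** * Powers of a 2-form *)

(** [lift_perm i j] maps ['S_n] bijectively onto the permutations sending [i] to [j]; for
    surjectivity, [i] is deleted from the source and [j] from the target. *)
Lemma sum_lift_perm (R : nmodType) n (i j : 'I_n.+1) (F : 'S_n.+1 -> R) :
  \sum_(s : 'S_n.+1 | s i == j) F s = \sum_(t : 'S_n) F (lift_perm i j t).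
Proof.
have lift_injP : {in predT &, injective (@lift_perm n i j)}.
  move=> t u _ _ /permP e; apply/permP => x; apply: (@lift_inj _ j).
  by rewrite -!(lift_perm_lift i) e.
rewrite -(big_imset F lift_injP) /=; apply: eq_bigl => s; apply/eqP/imsetP.
  move=> sij; have /fin_all_exists[f fP] x : exists y, s (lift i x) = lift j y.
    case: (unliftP j (s (lift i x))) => [y ->|e]; first by exists y.
    by have := neq_lift i x; rewrite -(inj_eq (@perm_inj _ s)) e sij eqxx.
  have f_inj : injective f.
    by move=> x y fxy; apply: (@lift_inj _ i); apply: (@perm_inj _ s); rewrite !fP fxy.
  exists (perm f_inj) => //; apply/permP => x; case: (unliftP i x) => [y|] ->.
    by rewrite lift_perm_lift permE fP.
  by rewrite lift_perm_id.
by case=> t _ ->; rewrite lift_perm_id.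
Qed.

Lemma sum_perm_head (R : nmodType) n (F : 'S_n.+1 -> R) :
  \sum_s F s = \sum_(j < n.+1) \sum_(t : 'S_n) F (lift_perm ord0 j t).
Proof.
rewrite (partition_big (fun s : 'S_n.+1 => s ord0) predT) //=.
by apply: eq_bigr => j _; rewrite sum_lift_perm.
Qed.

Section PairProduct.
Variables (R : comNzRingType) (V : Type) (g : V -> V -> R).

Fixpoint pairprod k : ('I_k.*2 -> V) -> R :=
  match k return ('I_k.*2 -> V) -> R with
  | 0 => fun=> 1
  | k'.+1 => fun x : 'I_k'.*2.+2 -> V => g (x ord0) (x (lift ord0 ord0)) *
      @pairprod k' (fun i => x (lift ord0 (lift ord0 i)))
  end.

Lemma pairprodS k (x : 'I_k.*2.+2 -> V) :
  @pairprod k.+1 x = g (x ord0) (x (lift ord0 ord0)) *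
    pairprod (fun i => x (lift ord0 (lift ord0 i))).
Proof. by []. Qed.
Arguments pairprod : simpl never.

Lemma eq_pairprod k (x y : 'I_k.*2 -> V) : x =1 y -> pairprod x = pairprod y.
Proof.
elim: k x y => [//|k IH] x y xy; rewrite !pairprodS !xy; congr (_ * _).
by apply: IH => i; rewrite xy.
Qed.

Hypothesis gC : forall u w, g u w = - g w u.

Lemma pairprod_tperm k (x : 'I_k.*2.+2 -> V) :
  @pairprod k.+1 (x \o tperm ord0 (lift ord0 ord0)) = - @pairprod k.+1 x.
Proof.
rewrite !pairprodS /= tpermL tpermR gC mulNr; congr (- (_ * _)).
by apply: eq_pairprod => i /=; rewrite tpermD.
Qed.

(** Exchange of the first two pairs as blocks; a product of two transpositions, hence even. *)
Definition pair_swap k : 'S_k.*2.+4 :=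
  (tperm ord0 (lift ord0 (lift ord0 ord0)) *
   tperm (lift ord0 ord0) (lift ord0 (lift ord0 (lift ord0 ord0))))%g.

Lemma pairprod_swap k (x : 'I_k.*2.+4 -> V) :
  @pairprod k.+2 (x \o pair_swap k) = @pairprod k.+2 x.
Proof.
rewrite !pairprodS /= /pair_swap !permM.
rewrite tpermL [tperm ord0 _ (lift ord0 (lift ord0 ord0))]tpermR.
rewrite ![tperm ord0 _ _]tpermD // tpermL tpermR !tpermD // mulrCA.
congr (_ * (_ * _)); apply: eq_pairprod => i /=.
by rewrite permM !tpermD.
Qed.

(** Serves to show that all positions of a given vector contribute equally to the alternating sum. A
    position in a later pair is brought to the front of the tail by induction, and then its pair is
    exchanged with the first one; position 1 takes one transposition, which antisymmetry of [g]
    turns into a sign. *)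
Lemma pairprod_move k (r : 'I_k.*2.+2) : exists s : 'S_k.*2.+2,
  s ord0 = r /\ forall x, @pairprod k.+1 (x \o s) = (-1) ^+ s * @pairprod k.+1 x.
Proof.
elim: k r => [|k IH] r; case: (unliftP ord0 r) => [r' ->|->].
- exists (tperm ord0 (lift ord0 ord0)); split=> [|x].
    by rewrite tpermL; congr lift; rewrite [r']ord1.
  by rewrite pairprod_tperm odd_tperm /= expr1 mulN1r.
- exists 1%g; split=> [|x]; first by rewrite perm1.
  by rewrite odd_perm1 mul1r; apply: eq_pairprod => i /=; rewrite perm1.
- case: (unliftP ord0 r') => [r'' ->|->].
    have [s [s0 sP]] := IH r''.
    pose s2 := lift_perm ord0 ord0 (lift_perm ord0 ord0 s).
    exists (pair_swap k * s2)%g; split=> [|x].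
      by rewrite !permM tpermL tpermD // /s2 !lift_perm_lift s0.
    rewrite (@eq_pairprod k.+2 _ ((x \o s2) \o pair_swap k)); last first.
      by move=> i; rewrite /= permM.
    rewrite pairprod_swap odd_permM {1}/pair_swap odd_permM !odd_tperm.
    have -> : odd_perm s2 = odd_perm s by rewrite /s2 !odd_lift_perm.
    rewrite addbb addFb (@pairprodS k.+1 x) mulrCA (@pairprodS k.+1 (x \o s2)).
    congr (_ * _).
      by rewrite /s2 /comp lift_perm_lift !lift_perm_id.
    rewrite -(sP (fun i => x (lift ord0 (lift ord0 i)))).
    by apply: eq_pairprod => i; rewrite /comp /s2 !lift_perm_lift.
  exists (tperm ord0 (lift ord0 ord0)); split=> [|x].
    by rewrite tpermL.
  by rewrite pairprod_tperm odd_tperm /= expr1 mulN1r.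
- exists 1%g; split=> [|x]; first by rewrite perm1.
  by rewrite odd_perm1 mul1r; apply: eq_pairprod => i /=; rewrite perm1.
Qed.

End PairProduct.
Arguments pairprod : simpl never.

Section ConsRow.
Variables (R : realType) (m : nat).
Implicit Types (u : 'rV[R]_m).

Lemma row_col_mx0 k u (v : 'M[R]_(k, m)) : row ord0 (col_mx u v : 'M[R]_(1 + k, m)) = u.
Proof.
have e0 : (ord0 : 'I_k.+1) = lshift k (ord0 : 'I_1) by exact/val_inj.
by rewrite e0; exact: etrans (rowKu _ u v) (row_id _ u).
Qed.

Lemma row_col_mxS k u (v : 'M[R]_(k, m)) j :
  row (lift ord0 j) (col_mx u v : 'M[R]_(1 + k, m)) = row j v.
Proof.
have -> : lift ord0 j = rshift 1 j :> 'I_k.+1 by exact/val_inj.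
exact: (rowKd j u v).
Qed.

Lemma row'_col_mx0 k u (v : 'M[R]_(k, m)) :
  row' (ord0 : 'I_k.+1) (col_mx u v : 'M[R]_(1 + k, m)) = v.
Proof. by apply/row_matrixP => i; rewrite row_rowsub row_col_mxS. Qed.

Lemma row'_col_mxS k u (v : 'M[R]_(k.+1, m)) j :
  row' (lift ord0 j : 'I_k.+2) (col_mx u v : 'M[R]_(1 + k.+1, m)) =
  (col_mx u (row' j v) : 'M[R]_(1 + k, m)).
Proof.
apply/row_matrixP => i; rewrite row_rowsub; case: (unliftP ord0 i) => [i' ->|->].
  rewrite row_col_mxS row_rowsub -(row_col_mxS u); congr row.
  by apply/val_inj; rewrite /= /bump /= !add1n ltnS; case: (j <= i')%N.
by rewrite row_col_mx0 -[RHS](row_col_mx0 u v); congr row; apply/val_inj.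
Qed.

Lemma setrow_col_mx0 k u x (v : 'M[R]_(k, m)) :
  setrow (ord0 : 'I_k.+1) x (col_mx u v : 'M[R]_(1 + k, m)) =
  (col_mx x v : 'M[R]_(1 + k, m)).
Proof.
apply/row_matrixP => i; rewrite rowK; case: (unliftP ord0 i) => [j ->|->] /=.
  by rewrite !row_col_mxS.
by rewrite row_col_mx0.
Qed.

Lemma setrow_col_mxS k u x (v : 'M[R]_(k, m)) j :
  setrow (lift ord0 j : 'I_k.+1) x (col_mx u v : 'M[R]_(1 + k, m)) =
  (col_mx u (setrow j x v) : 'M[R]_(1 + k, m)).
Proof.
have -> : lift ord0 j = rshift 1 j :> 'I_k.+1 by exact/val_inj.
by rewrite col_mx_setrowS.
Qed.

End ConsRow.

Section AltSum.
Variables (R : realType) (m : nat) (g : 'rV[R]_m -> 'rV[R]_m -> R).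
Hypothesis gC : forall u w, g u w = - g w u.

Definition altsum k (v : 'M[R]_(k.*2, m)) : R :=
  \sum_(s : 'S_k.*2) (-1) ^+ s * pairprod g (fun i => row (s i) v).

Lemma altsum_alternating k : alternating (@altsum k).
Proof.
move=> i j v ij e; rewrite /altsum.
set S := (X in X = 0); have SN : S = - S.
  rewrite {1}/S (reindex_inj (mulIg (tperm i j))) /= -sumrN.
  apply: eq_bigr => s _; rewrite odd_permM odd_tperm ij signr_addb expr1.
  rewrite mulrN1 mulNr; congr (- (_ * _)); apply: eq_pairprod => x.
  by rewrite permM; case: tpermP => [->|->|].
by apply/eqP; move/eqP: SN; rewrite -addr_eq0 -mulr2n mulrn_eq0.
Qed.

(** The vector [u] can occupy 2k+2 positions, all contributing equally by [pairprod_move]. With [u]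
    in front, the sum runs over its partner [row j v] and the permutations of the remaining rows. *)
Lemma altsum_expand k (u : 'rV[R]_m) (v : 'M[R]_(k.*2.+1, m)) :
  altsum (k := k.+1) (col_mx u v : 'M[R]_(1 + k.*2.+1, m)) =
  (k.+1.*2)%:R * \sum_(j < k.*2.+1) (-1) ^+ j * (g u (row j v) * altsum (row' j v)).
Proof.
rewrite /altsum; set c : 'M[R]_(k.*2.+2, m) := col_mx u v.
have c0 : row ord0 c = u := row_col_mx0 u v.
have cS j : row (lift ord0 j) c = row j v := row_col_mxS u v j.
pose F (s : 'S_k.*2.+2) := (-1) ^+ s * pairprod g (k := k.+1) (fun i => row (s i) c).
rewrite -[LHS]/(\sum_s F s).
(* The block of index [r] collects the permutations that place [u] at position [r]. *)
rewrite (partition_big (fun s : 'S_k.*2.+2 => s^-1%g ord0) predT) //=.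
have step (r : 'I_k.*2.+2) : \sum_(s : 'S_k.*2.+2 | s^-1%g ord0 == r) F s =
    \sum_(s : 'S_k.*2.+2 | s ord0 == ord0) F s.
  have [t [t0 tP]] := pairprod_move gC r.
  rewrite [RHS](reindex_inj (mulgI t)) /=; apply: eq_big => s.
    by rewrite permM t0 -(inj_eq (@perm_inj _ s)) permKV eq_sym.
  move=> _; rewrite /F odd_permM signr_addb.
  rewrite (@eq_pairprod _ _ g k.+1 (fun i => row ((t * s)%g i) c)
    ((fun i => row (s i) c) \o t)); last by move=> i; rewrite /comp permM.
  rewrite tP mulrA [X in _ = X * _](_ : _ = (-1) ^+ s) //.
  by rewrite mulrAC -signr_addb addbb mul1r.
rewrite (eq_bigr _ (fun r _ => step r)) sumr_const card_ord -[LHS]mulr_natl.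
congr (_ * _); rewrite sum_lift_perm sum_perm_head; apply: eq_bigr => j _.
rewrite !mulr_sumr; apply: eq_bigr => t _.
rewrite /F !odd_lift_perm /= pairprodS lift_perm_id lift_perm_lift lift_perm_id.
rewrite c0 cS signr_addb signr_odd -!mulrA; congr (_ * _).
rewrite mulrCA; congr (_ * (_ * _)); apply: eq_pairprod => i.
rewrite !lift_perm_lift cS; by apply/rowP => x; rewrite !mxE.
Qed.

(** Each wedge product carries the factor 1/(2! (2k)!). The (2k)! permutations inside the smaller
    power are absorbed by the outer sum, which leaves 1/2 per factor. *)
Lemma wpow_altsum (a : form R m 2) k p :
  (forall v, a p v = g (row 0 v) (row 1 v)) ->
  forall v, wpow a k p v = 2 ^- k * altsum v.
Proof.
move=> aE; elim: k => [|k IH] v.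
  rewrite /altsum -[LHS]/(1 : R) expr0 invr1 mul1r.
  rewrite (eq_bigr (fun=> 1)) => [|s _]; last first.
    have -> : s = 1%g by apply/permP => -[].
    by rewrite odd_perm1 mul1r.
  by rewrite sumr_const card_Sn.
rewrite -[LHS]/(wedge a (wpow a k) p v) /wedge.
pose F (s : 'S_k.*2.+2) := (-1) ^+ s * pairprod g (k := k.+1) (fun i => row (s i) v).
pose l2 (t : 'S_k.*2) := lift_perm ord0 ord0 (lift_perm ord0 ord0 t).
(* The inner permutation [t] becomes [l2 t], which fixes the first two positions; after reindexing,
   each [t] reproduces the full alternating sum. *)
rewrite (eq_bigr (fun s : 'S_k.*2.+2 => 2 ^- k * \sum_(t : 'S_k.*2) F (l2 t * s)%g)).
  rewrite -mulr_sumr exchange_big /= (eq_bigr (fun=> \sum_s F s)); last first.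
    by move=> t _; rewrite [RHS](reindex_inj (mulgI (l2 t))).
  rewrite sumr_const card_Sn -mulr_natl.
  rewrite /altsum -/(\sum_s F s) natrM exprS !invfM.
  have : ((k.*2)`!%:R : R) != 0 by rewrite pnatr_eq0 -lt0n fact_gt0.
  by move=> h; rewrite [2`!%:R](_ : _ = 2) //; field; rewrite ?h ?expf_neq0.
move=> s _; rewrite IH aE.
rewrite mulrA [LHS]mulrCA; congr (_ * _).
rewrite /altsum !mulr_sumr; apply: eq_bigr => t _.
have l2t0 : l2 t ord0 = ord0 by rewrite /l2 lift_perm_id.
have l2t1 : l2 t (lift ord0 ord0) = lift ord0 ord0.
  by rewrite /l2 lift_perm_lift lift_perm_id.
have l2tS i : l2 t (lift ord0 (lift ord0 i)) = lift ord0 (lift ord0 (t i)).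
  by rewrite /l2 !lift_perm_lift.
rewrite /F odd_permM signr_addb /l2 !odd_lift_perm /= -/(l2 t) pairprodS.
rewrite !permM l2t0 l2t1 mulrACA [X in X * _ = _]mulrC; congr (_ * (_ * _)).
  by congr (g _ _); apply/rowP => x; rewrite !mxE; congr (v (s _) _); apply/val_inj.
apply: eq_pairprod => i; rewrite permM l2tS; apply/rowP => x; rewrite !mxE.
by congr (v (s _) _); apply/val_inj.
Qed.
End AltSum.

Section WedgePower.
Variables (R : realType) (m : nat) (g : 'rV[R]_m -> 'rV[R]_m -> R).
Hypothesis gC : forall u w, g u w = - g w u.
Variables (a : form R m 2) (p : torus R m).
Hypothesis aE : forall v, a p v = g (row 0 v) (row 1 v).
Implicit Types (u w : 'rV[R]_m).

Lemma wpow_alternating k : alternating (wpow a k p).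
Proof.
by move=> i j v ij e; rewrite (wpow_altsum aE) (altsum_alternating g ij e) mulr0.
Qed.

(** This is i_u a^(k+1) = (k+1) (i_u a) /\ a^k, written out on vectors. *)
Lemma wpow_expand k u (v : 'M[R]_(k.*2.+1, m)) :
  wpow a k.+1 p (col_mx u v : 'M[R]_(1 + k.*2.+1, m)) =
  k.+1%:R * \sum_(j < k.*2.+1) (-1) ^+ j * (g u (row j v) * wpow a k p (row' j v)).
Proof.
rewrite (wpow_altsum aE) altsum_expand //.
under [in RHS]eq_bigr => j _ do
  rewrite (wpow_altsum aE) [_ * (2 ^- k * _)]mulrCA [_ * (2 ^- k * _)]mulrCA.
rewrite -mulr_sumr !mulrA; congr (_ * _).
by rewrite -muln2 natrM exprS; field; rewrite expf_neq0.
Qed.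

Variable A : 'rV[R]_m -> 'rV[R]_m.

(* The infinitesimal actions of the endomorphism A on the k-th power of a, and on a. *)
Definition wpow_der k (v : 'M[R]_(k.*2, m)) : R :=
  \sum_(i < k.*2) wpow a k p (setrow i (A (row i v)) v).

Definition der2 u w := g (A u) w + g u (A w).

Lemma der2C u w : der2 u w = - der2 w u.
Proof. by rewrite /der2 gC [g u _]gC opprD addrC. Qed.

(** Product rule applied to [wpow_expand]: the terms where [A] hits [u] or its partner combine into
    [der2], the others into [wpow_der] of the remaining rows. *)
Lemma wpow_der_expand k u (v : 'M[R]_(k.*2.+1, m)) :
  wpow_der (k := k.+1) (col_mx u v : 'M[R]_(1 + k.*2.+1, m)) =
  k.+1%:R * \sum_(j < k.*2.+1) (-1) ^+ j *
    (der2 u (row j v) * wpow a k p (row' j v) + g u (row j v) * wpow_der (row' j v)).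
Proof.
set c : 'M[R]_(k.*2.+2, m) := col_mx u v.
have c0 : row ord0 c = u := row_col_mx0 u v.
have cS j : row (lift ord0 j) c = row j v := row_col_mxS u v j.
have s0 x : setrow ord0 x c = (col_mx x v : 'M[R]_(1 + k.*2.+1, m)).
  exact: setrow_col_mx0.
have sS j x : setrow (lift ord0 j) x c = (col_mx u (setrow j x v) : 'M[R]_(1 + k.*2.+1, m)).
  exact: setrow_col_mxS.
rewrite /wpow_der big_ord_recl c0 s0 wpow_expand.
under [X in _ + X = _]eq_bigr => i _ do rewrite cS sS wpow_expand.
rewrite -mulr_sumr -mulrDr; congr (_ * _).
rewrite exchange_big /= -big_split; apply: eq_bigr => j _ /=.
rewrite -mulr_sumr -mulrDr; congr (_ * _).
(* The summand split off has [A] acting on the partner [row j v] of [u]. *)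
rewrite (bigD1_ord j) //= /der2 mulrDl -!addrA; congr (_ + _).
congr (_ + _).
  congr (g _ _ * wpow a k p _); first by rewrite rowK eqxx.
  by apply/row_matrixP => i; rewrite !row_rowsub rowK eq_sym (negbTE (neq_lift _ _)).
rewrite mulr_sumr; apply: eq_bigr => i _.
congr (g _ _ * wpow a k p _); first by rewrite rowK (negbTE (neq_lift _ _)).
apply/row_matrixP => i'; rewrite !(rowK, row_rowsub) (inj_eq lift_inj).
by case: eqP.
Qed.

Lemma wpow_perp k u (v : 'M[R]_(k.*2.+1, m)) : (forall j, g u (row j v) = 0) ->
  wpow a k.+1 p (col_mx u v : 'M[R]_(1 + k.*2.+1, m)) = 0.
Proof.
by move=> uv; rewrite wpow_expand big1 ?mulr0 // => j _; rewrite uv mul0r mulr0.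
Qed.

Lemma wpow_pair k u w (v : 'M[R]_(k.*2, m)) : (forall j, g u (row j v) = 0) ->
  wpow a k.+1 p (col_mx u (col_mx w v : 'M[R]_(1 + k.*2, m)) : 'M[R]_(1 + k.*2.+1, m)) =
  k.+1%:R * (g u w * wpow a k p v).
Proof.
move=> uv; rewrite wpow_expand big_ord_recl big1 => [|j _]; last first.
  by rewrite row_col_mxS uv mul0r mulr0.
by rewrite addr0 row_col_mx0 row'_col_mx0 expr0 mul1r.
Qed.

Lemma wpow_der_pair k u w (v : 'M[R]_(k.*2, m)) :
  (forall j, g u (row j v) = 0) -> (forall j, g w (row j v) = 0) ->
  wpow_der (k := k.+1)
    (col_mx u (col_mx w v : 'M[R]_(1 + k.*2, m)) : 'M[R]_(1 + k.*2.+1, m)) =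
  k.+1%:R * (der2 u w * wpow a k p v + g u w * wpow_der v).
Proof.
move=> uv wv; rewrite wpow_der_expand big_ord_recl big1 => [|j _]; last first.
  rewrite row_col_mxS uv mul0r addr0.
  case: k v uv wv j => [v _ _ []//|k v uv wv j].
  (* The rows left over still contain [w], which is orthogonal to all the others, so the power
     vanishes on them. *)
  rewrite row'_col_mxS wpow_perp ?mulr0 // => i.
  by rewrite row_rowsub wv.
by rewrite addr0 row_col_mx0 row'_col_mx0 expr0 mul1r.
Qed.

End WedgePower.

(** * The standard symplectic form on Darboux frames *)

Section Symplectic.
Variables (R : realType) (n : nat).
Implicit Types (u w : 'rV[R]_(n + n)).

Local Notation p_ i := (lshift n i).
Local Notation q_ i := (rshift n i).

Definition sympl u w : R :=
  \sum_(i < n) (u 0 (p_ i) * w 0 (q_ i) - u 0 (q_ i) * w 0 (p_ i)).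

Lemma symplC u w : sympl u w = - sympl w u.
Proof. by rewrite /sympl -sumrN; apply: eq_bigr => i _; ring. Qed.

Lemma sympl_linl c u u' w : sympl (c *: u + u') w = c * sympl u w + sympl u' w.
Proof.
rewrite /sympl mulr_sumr -big_split; apply: eq_bigr => i _ /=.
by rewrite !mxE; ring.
Qed.

Lemma sympl_linr c u w w' : sympl u (c *: w + w') = c * sympl u w + sympl u w'.
Proof.
by rewrite symplC sympl_linl opprD -mulrN -!symplC.
Qed.

Lemma omegaE p (v : 'M[R]_(2, n + n)) : omega p v = sympl (row 0 v) (row 1 v).
Proof.
rewrite /omega (big_morph (fun a : form R (n + n) 2 => a p v) (id1 := 0)
  (op1 := +%R)) //; apply: eq_bigr => i _.
rewrite /wedge /dcoord (_ : (1`! * 1`!)%N = 1%N) // invr1 mul1r.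
pose F (s : 'S_2) : R :=
  (-1) ^+ s * (usubmx (row_perm s v : 'M[R]_(1 + 1, n + n)) 0 (p_ i) *
    dsubmx (row_perm s v : 'M[R]_(1 + 1, n + n)) 0 (q_ i)).
rewrite -[LHS]/(\sum_s F s) sum_perm_head.
rewrite (eq_bigr (fun j => F (lift_perm ord0 j 1%g))) => [|j _]; last first.
  rewrite (eq_bigr (fun=> F (lift_perm ord0 j 1%g))) => [|t _].
    by rewrite sumr_const card_Sn.
  by congr (F (lift_perm _ _ _)); apply/permP => x; rewrite [x]ord1 [t _]ord1 [RHS]ord1.
rewrite 2!big_ord_recl big_ord0 addr0 /F !odd_lift_perm !odd_perm1 !mxE /=.
have e0 : lshift 1 (0 : 'I_1) = ord0 :> 'I_2 by exact/val_inj.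
have e1 : rshift 1 (0 : 'I_1) = lift ord0 ord0 :> 'I_2 by exact/val_inj.
rewrite e0 e1 !lift_perm_id !lift_perm_lift !perm1 /= !expr0 !expr1 mul1r mulN1r.
rewrite [in X in _ - X]mulrC; congr (v _ _ * v _ _ - v _ _ * v _ _); exact/val_inj.
Qed.

Lemma sympl_p i w : sympl (delta_mx 0 (p_ i)) w = w 0 (q_ i).
Proof.
rewrite /sympl (bigD1 i) //= big1 ?addr0 => [|j ij].
  by rewrite !mxE !eqxx eq_rlshift /= mul1r mul0r subr0.
by rewrite !mxE eqxx eq_rlshift eq_lshift (negbTE ij) /= !mul0r subr0.
Qed.

Lemma sympl_q i w : sympl (delta_mx 0 (q_ i)) w = - w 0 (p_ i).
Proof.
rewrite /sympl (bigD1 i) //= big1 ?addr0 => [|j ij].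
  by rewrite !mxE !eqxx eq_lrshift /= mul1r mul0r sub0r.
by rewrite !mxE eqxx eq_lrshift eq_rshift (negbTE ij) /= !mul0r subr0.
Qed.

(** The number of the conjugate pair to which a coordinate belongs. *)
Definition sympl_index (x : 'I_(n + n)) : 'I_n :=
  match fintype.split x with inl i => i | inr i => i end.

Lemma sympl_index_p i : sympl_index (p_ i) = i.
Proof. by rewrite /sympl_index (unsplitK (inl i)). Qed.

Lemma sympl_index_q i : sympl_index (q_ i) = i.
Proof. by rewrite /sympl_index (unsplitK (inr i)). Qed.

Lemma sympl_delta x y : sympl_index x != sympl_index y ->
  sympl (delta_mx 0 x) (delta_mx 0 y) = 0.
Proof.
case: (split_ordP x) => i ->; rewrite (sympl_index_p, sympl_index_q);
case: (split_ordP y) => j ->; rewrite ?(sympl_index_p, sympl_index_q) => ij;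
by rewrite (sympl_p, sympl_q) !mxE ?eq_lshift ?eq_rshift ?eq_lrshift ?eq_rlshift
  ?(negbTE ij) ?andbF ?oppr0.
Qed.

Fixpoint darboux (s : seq 'I_n) : 'M[R]_((size s).*2, n + n) :=
  match s return 'M[R]_((size s).*2, n + n) with
  | [::] => 0
  | i :: s' => col_mx (delta_mx 0 (p_ i))
      (col_mx (delta_mx 0 (q_ i)) (darboux s') : 'M[R]_(1 + (size s').*2, n + n))
      : 'M[R]_(1 + (size s').*2.+1, n + n)
  end.

Lemma darboux_perp (s : seq 'I_n) x : sympl_index x \notin s ->
  forall j, sympl (delta_mx 0 x) (row j (darboux s)) = 0.
Proof.
elim: s => [_ []//|i s IH] /=; rewrite inE negb_or => /andP[xi xs] j.
case: (unliftP ord0 j) => [j' ->|->]; last first.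
  by rewrite (row_col_mx0 (k := (size s).*2.+1)) sympl_delta // sympl_index_p.
rewrite (row_col_mxS (k := (size s).*2.+1)).
case: (unliftP ord0 j') => [j'' ->|->]; last first.
  by rewrite (row_col_mx0 (k := (size s).*2)) sympl_delta // sympl_index_q.
by rewrite (row_col_mxS (k := (size s).*2)) IH.
Qed.

Variable p : torus R (n + n).

Lemma wpow_darboux (s : seq 'I_n) : uniq s ->
  wpow (@omega R n) (size s) p (darboux s) = (size s)`!%:R.
Proof.
elim: s => [//|i s IH] /andP[si us]; rewrite (wpow_pair symplC (omegaE p)).
  by rewrite IH // sympl_p mxE !eqxx mul1r factS natrM.
by apply: darboux_perp; rewrite sympl_index_p.
Qed.

Variable A : 'rV[R]_(n + n) -> 'rV[R]_(n + n).
Local Notation B := (der2 sympl A).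

(** The pairs of a Darboux frame are mutually orthogonal, so [wpow_der_pair] removes them one by
    one, each leaving its own value of [der2]. *)
Lemma wpow_der_darboux (s : seq 'I_n) : uniq s ->
  wpow_der (@omega R n) p A (darboux s) =
  (size s)`!%:R * \sum_(i <- s) B (delta_mx 0 (p_ i)) (delta_mx 0 (q_ i)).
Proof.
elim: s => [_|i s IH] /=.
  by rewrite big_nil mulr0 /wpow_der big1 // => -[].
move=> /andP[si us]; rewrite (wpow_der_pair symplC (omegaE p)).
- rewrite IH // wpow_darboux // sympl_p mxE !eqxx mul1r big_cons factS natrM.
  by ring.
- by apply: darboux_perp; rewrite sympl_index_p.
- by apply: darboux_perp; rewrite sympl_index_q.
Qed.

(** Supplies Darboux frames disjoint from given pairs: without [i] and [j] at least n-2 >= k indices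
    remain. *)
Lemma uniq_seq_avoid k (i j : 'I_n) : (k.+1 < n)%N ->
  exists s : seq 'I_n, [/\ uniq s, size s = k, i \notin s & j \notin s].
Proof.
move=> kn; pose S := ~: [set i; j]%SET.
have kS : (k <= size (enum S))%N.
  rewrite -cardE; have := cardsC [set i; j]%SET.
  by rewrite -/S card_ord cards2; case: (i != j) => /=; lia.
exists (take k (enum S)); split.
- exact/take_uniq/enum_uniq.
- exact: size_takel.
- by apply/negP => /mem_take; rewrite mem_enum !inE eqxx.
- by apply/negP => /mem_take; rewrite mem_enum !inE eqxx orbT.
Qed.

(* wpow_der is a multiple of der2 /\ omega^k, so this is injectivity of the exterior
   product with omega^k on 2-forms. Darboux pairs disjoint from x and y isolate
   der2 on (x, y); for a conjugate pair only sums over k+1 pairs are isolated, and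
   exchanging one pair, possible as k+1 < n, shows that the terms are all equal. *)
Lemma wpow_der_inj k : (k.+1 < n)%N ->
  (forall v, wpow_der (@omega R n) p A (k := k.+1) v = 0) ->
  forall x y, B (delta_mx 0 x) (delta_mx 0 y) = 0.
Proof.
move=> kn T0.
have k0 j : (j`!%:R : R) != 0 by rewrite pnatr_eq0 -lt0n fact_gt0.
pose b i := B (delta_mx 0 (p_ i)) (delta_mx 0 (q_ i)).
have sum0 s : uniq s -> size s = k.+1 -> \sum_(i <- s) b i = 0.
  move=> us ss; have := wpow_der_darboux us.
  move: (darboux s); rewrite ss => v; rewrite T0 => /esym/eqP.
  by rewrite mulf_eq0 (negbTE (k0 _)) => /eqP.
have beq i j : b i = b j.
  have [s [us ss si sj]] := uniq_seq_avoid i j kn.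
  have := sum0 (i :: s); have := sum0 (j :: s).
  rewrite /= us si sj ss !big_cons => /(_ isT erefl) ej /(_ isT erefl) ei.
  by apply: (addIr (\sum_(l <- s) b l)); rewrite ei ej.
have b0 i : b i = 0.
  have [s [us ss si _]] := uniq_seq_avoid i i kn.
  have := sum0 (i :: s); rewrite /= us si ss => /(_ isT erefl).
  rewrite (eq_bigr (fun=> b i)) // big_const_seq count_predT [size _]/= ss iter_addr_0.
  by move/eqP; rewrite mulrn_eq0 => /eqP.
move=> x y; have [exy|nxy] := eqVneq (sympl_index x) (sympl_index y); last first.
  have [s [us ss xs ys]] := uniq_seq_avoid (sympl_index x) (sympl_index y) kn.
  have Wd := wpow_darboux us.
  have xp := darboux_perp xs; have yp := darboux_perp ys.
  move: (darboux s) Wd xp yp; rewrite ss => v Wd xp yp.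
  have := wpow_der_pair symplC (omegaE p) A xp yp.
  rewrite T0 sympl_delta // mul0r addr0 Wd => /esym/eqP.
  by rewrite !mulf_eq0 pnatr_eq0 (negbTE (k0 _)) orbF => /eqP.
have Bxx u : B u u = 0.
  by apply/eqP; move/eqP: (der2C symplC A u u); rewrite -addr_eq0 -mulr2n mulrn_eq0.
move: exy; case: (split_ordP x) => i ->; rewrite (sympl_index_p, sympl_index_q);
  case: (split_ordP y) => j ->; rewrite ?(sympl_index_p, sympl_index_q) => ->; rewrite ?Bxx //; last rewrite (der2C symplC).
- exact: (b0 j).
- by apply/eqP; rewrite oppr_eq0; apply/eqP; exact: (b0 j).
Qed.

End Symplectic.

(** * Primitives of closed 1-forms *)

Section Lines.
Variables (R : realType) (m : nat).
Implicit Types (G : 'rV[R]_m -> R) (x v : 'rV[R]_m).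

Lemma is_derive_line G x v (t : R) : derivable G (x + t *: v) v ->
  is_derive t 1 (fun s => G (x + s *: v)) ('D_v G (x + t *: v)).
Proof.
have e : (fun h : R => h^-1 *: (G (x + (h *: 1 + t) *: v) - G (x + t *: v))) =
    (fun h => h^-1 *: (G (h *: v + (x + t *: v)) - G (x + t *: v))).
  apply/funext => h; congr (_ *: (G _ - _)).
  by rewrite scalerDl addrCA /GRing.scale /= mulr1.
by move=> dG; split; [rewrite /derivable /= e|rewrite /derive /= e].
Qed.

Lemma line_MVT G x v (s : R) : (forall y, derivable G y v) -> 0 <= s ->
  exists2 c, c \in `[0, s] & G (x + s *: v) - G x = s * 'D_v G (x + c *: v).
Proof.
move=> dG s0.
have dl (t : R) : is_derive t 1 (fun s : R => G (x + s *: v)) ('D_v G (x + t *: v)).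
  exact: is_derive_line.
have cl : {within `[0, s], continuous (fun s : R => G (x + s *: v))}.
  by apply: derivable_within_continuous => t _; exact: ex_derive.
have [c cs] := MVT_segment s0 (fun t _ => dl t) cl.
by rewrite scale0r addr0 subr0 mulrC => e; exists c.
Qed.

Lemma derive_dirZ G x v c : differentiable G x -> 'D_(c *: v) G x = c * 'D_v G x.
Proof. by move=> dG; rewrite !deriveE // linearZ. Qed.

Lemma continuous_bounded_ball G (r : R) : continuous G ->
  exists M, forall y, `|y| <= r -> `|G y| <= M.
Proof.
move=> cG; pose A := [set y : 'rV[R]_m | `|y| <= r].
have cA : compact A.
  apply: bounded_closed_compact.
    exists r; split=> [|s rs y /le_trans]; first exact: num_real.
    by apply; exact: ltW.
  by apply: (@closed_comp _ _ (fun y : 'rV[R]_m => `|y|) [set t : R | t <= r]);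
    [move=> y _; exact: norm_continuous|exact: closed_le].
have [r0|r0] := ltP r 0.
  by exists 0 => y /le_lt_trans /(_ r0); rewrite normr_lt0.
have A0 : A !=set0 by exists 0; rewrite /A /= normr0.
have cN : {within A, continuous (fun y => `|G y|)}.
  apply: continuous_subspaceT => y; apply: continuous_comp; first exact: cG.
  exact: norm_continuous.
have [c _ cP] := EVT_max_rV A0 cA cN.
by exists `|G c| => y yr; apply: cP; rewrite inE.
Qed.

End Lines.

Section Poincare.
Variables (R : realType) (m : nat) (a : 'rV[R]_m -> {linear 'rV[R]_m -> R}).
Implicit Types (x u v w : 'rV[R]_m).
Local Notation ac v := (fun x => a x v).
Hypothesis da : forall v x, differentiable (ac v) x.
Hypothesis ca : forall u v, continuous ('D_u (ac v)).
Hypothesis closed_a : forall u v x, 'D_u (ac v) x = 'D_v (ac u) x.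
Local Notation mu := (@lebesgue_measure R).

(** The line integral of the 1-form [a] along the segment from 0 to [x], as in the Poincare
    lemma. *)
Definition primitive x : R := \int[mu]_(t in `[0, 1]) a (t *: x) x.

Lemma continuous_ac v : continuous (ac v).
Proof. by move=> x; apply: differentiable_continuous. Qed.

(** Differentiation under the integral sign along [x + s v], followed by the fundamental theorem of
    calculus in [t]. *)
Lemma derive_primitive x v :
  is_derive x v primitive (a x v).
Proof.
(* [h] is the integrand of [primitive] at [x + s v]. In its [s]-derivative [h'], closedness has
   replaced the derivative of [ac x] along [v] by that of [ac v] along [x]. *)
pose h (s t : R) : R := a (t *: (x + s *: v)) (x + s *: v).
pose h' (s t : R) : R := a (t *: (x + s *: v)) v
  + t * 'D_x (ac v) (t *: (x + s *: v)) + s * t * 'D_v (ac v) (t *: (x + s *: v)).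
have dh (s t : R) : is_derive s 1 (h^~ t) (h' s t).
  have dw w : is_derive s 1 (fun s : R => a (t *: (x + s *: v)) w)
      (t * 'D_v (ac w) (t *: (x + s *: v))).
    have -> : (fun s => a (t *: (x + s *: v)) w) =
        (fun s => ac w (t *: x + s *: (t *: v))).
      by apply/funext => r; rewrite scalerDr !scalerA mulrC.
    have e : t *: x + s *: (t *: v) = t *: (x + s *: v).
      by rewrite scalerDr !scalerA mulrC.
    rewrite -derive_dirZ // -e; apply: is_derive_line.
    exact: diff_derivable.
  have -> : h^~ t = (fun s => a (t *: (x + s *: v)) x) +
      (fun s => s) * (fun s => a (t *: (x + s *: v)) v).
    by apply/funext => r; rewrite /h linearD linearZ.
  apply: is_derive_eq; rewrite /h' /GRing.scale /= (closed_a v x).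
  by rewrite mulr1; ring.
have ct w (s : R) : continuous (fun t : R => a (t *: (x + s *: v)) w).
  move=> t; apply: (@continuous_comp _ _ _ (fun t : R => t *: (x + s *: v)) (ac w)).
    exact: scalel_continuous.
  exact: continuous_ac.
have ch s : continuous (h s).
  by move=> t; apply: ct.
have inth s : mu.-integrable `[0, 1] (EFin \o h s).
  apply: continuous_compact_integrable; first exact: segment_compact.
  exact: continuous_subspaceT.
(* For |s|, |t| <= 1 the point t(x + sv) stays in the ball of radius [r], on which the three
   functions occurring in [h'] are bounded; [M] is the dominating constant. *)
pose r := `|x| + `|v|.
have [M1 M1P] := continuous_bounded_ball r (@continuous_ac v).
have [M2 M2P] := continuous_bounded_ball r (@ca x v).
have [M3 M3P] := continuous_bounded_ball r (@ca v v).
pose M := `|M1| + `|M2| + `|M3|.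
have h'M s t : `](-1), 1[%classic s -> `[0, 1]%classic t -> `|partial1of2 h s t| <= M.
  rewrite /= !in_itv /= => /andP[s1 s2] /andP[t0 t1].
  rewrite partial1of2E (@derive_val _ _ _ _ _ _ _ (dh s t)).
  have ns : `|s| <= 1 by rewrite ler_norml !ltW.
  have nt : `|t| <= 1 by rewrite ger0_norm.
  have ny : `|t *: (x + s *: v)| <= r.
    rewrite normrZ -[r]mul1r ler_pM //.
    apply: le_trans (ler_normD _ _) _; rewrite lerD2l normrZ.
    by rewrite -[leRHS]mul1r ler_wpM2r.
  have lM (N z : R) : `|z| <= N -> `|z| <= `|N|.
    by move=> /le_trans; apply; exact: ler_norm.
  rewrite /h' /M; apply: le_trans (ler_normD _ _) _; rewrite lerD //.
    apply: le_trans (ler_normD _ _) _; rewrite lerD //; first exact/lM/M1P.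
    by rewrite normrM -[leRHS]mul1r ler_pM //; exact/lM/M2P.
  rewrite normrM -[leRHS]mul1r ler_pM //; last exact/lM/M3P.
  by rewrite normrM -[leRHS]mul1r ler_pM.
have I0 : `](-1), 1[%classic (0 : R) by rewrite /= in_itv /= ltrN10 ltr01.
have mI : measurable (`[0, 1]%classic : set (measurableTypeR R)) by [].
have M0 : 0 <= M by rewrite !addr_ge0.
have intM : mu.-integrable `[0, 1] (EFin \o cst M).
  apply: continuous_compact_integrable; first exact: segment_compact.
  by apply: continuous_subspaceT => ?; exact: cvg_cst.
have dh1 s t : `](-1), 1[%classic s -> `[0, 1]%classic t -> derivable (h^~ t) s 1.
  by move=> _ _; exact: ex_derive.
have ih s : `](-1), 1[%classic s -> mu.-integrable `[0, 1] (EFin \o h s) by [].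
have dI := derivable_under_integral (mu := mu) mI I0 ih dh1 (fun=> M0) intM h'M.
have vI := differentiation_under_integral (mu := mu) mI I0 ih dh1 (fun=> M0) intM h'M.
have hE : (fun s : R => \int[mu]_(t in `[0, 1]) h s t) = (fun s => primitive (s *: v + x)).
  by apply: funext => s; rewrite [in RHS]addrC.
split; first by apply: (iffRL (derivable1P primitive x v)); rewrite -hE.
have -> : 'D_v primitive x = 'D_1 (fun s : R => primitive (s *: v + x)) 0.
  apply: (congr1 (fun g : R -> R => lim (g @ 0^'))); apply/funext => s /=.
  by rewrite addr0 scale0r add0r /GRing.scale /= mulr1.
rewrite -hE -derive1E vI.
(* By closedness the integrand is the derivative of t |-> t a(tx)(v). *)
pose H (t : R) : R := t * a (t *: x) v.
have dH (t : R) : is_derive t 1 H (partial1of2 h 0 t).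
  have dt : is_derive t 1 (fun t : R => a (t *: x) v) ('D_x (ac v) (t *: x)).
    have -> : (fun t => a (t *: x) v) = (fun s => ac v (0 + s *: x)).
      by apply/funext => s; rewrite add0r.
    rewrite -[t *: x]add0r; apply: is_derive_line; exact: diff_derivable.
  have -> : H = (fun t => t) * (fun t => a (t *: x) v) by [].
  apply: is_derive_eq.
  rewrite partial1of2E (@derive_val _ _ _ _ _ _ _ (dh 0 t)) /h' scale0r addr0.
  by rewrite !mul0r addr0 /GRing.scale /=; ring.
have cH : continuous H.
  by move=> t; apply/differentiable_continuous/derivable1_diffP; exact: ex_derive.
rewrite /Rintegral (@continuous_FTC2 _ _ H) ?ltr01 //.
- by rewrite /H /= mul0r subr0 mul1r scale1r.
- apply: continuous_subspaceT; rewrite (_ : partial1of2 h 0 =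
    (fun t : R => a (t *: x) v) + (fun t => t * 'D_x (ac v) (t *: x))).
    move=> t; apply: continuousD.
      apply: (@continuous_comp _ _ _ (fun t : R => t *: x) (ac v)).
        exact: scalel_continuous.
      exact: continuous_ac.
    apply: continuousM; first exact: cvg_id.
    apply: (@continuous_comp _ _ _ (fun t : R => t *: x) ('D_x (ac v))).
      exact: scalel_continuous.
    exact: ca.
  apply/funext => t; rewrite partial1of2E (@derive_val _ _ _ _ _ _ _ (dh 0 t)) /h'.
  by rewrite scale0r addr0 !mul0r addr0.
- split=> [t _||]; first exact: ex_derive.
  + apply: cvg_at_right_filter; exact: cH.
  + apply: cvg_at_left_filter; exact: cH.
- by move=> t _; rewrite derive1E (@derive_val _ _ _ _ _ _ _ (dH t)).
Qed.

End Poincare.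

(** * Smoothness and periods of a primitive *)

Section LinearForms.
Variables (R : realType) (m : nat).
Implicit Types (L : {linear 'rV[R]_m -> R}) (v : 'rV[R]_m).

Lemma coord_le_norm v j : `|v 0 j| <= `|v|.
Proof.
rewrite [leRHS]/Num.Def.normr/= mx_normrE.
exact: (le_bigmax _ (fun ij : 'I_1 * 'I_m => `|v ij.1 ij.2|) (0, j)).
Qed.

Lemma linear_rVE L v : L v = \sum_j v 0 j * L (delta_mx 0 j).
Proof.
rewrite {1}(row_sum_delta v) linear_sum; apply: eq_bigr => j _.
by rewrite linearZ.
Qed.

Lemma linear_rV_continuous L : continuous L.
Proof.
apply/bounded_linear_continuous/linear_boundedP; near=> r => v.
apply: le_trans (_ : (\sum_j `|L (delta_mx 0 j)|) * `|v| <= _).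
  rewrite linear_rVE; apply: le_trans (ler_norm_sum _ _ _) _.
  rewrite mulr_suml; apply: ler_sum => j _.
  by rewrite normrM mulrC ler_wpM2l // coord_le_norm.
by apply: ler_wpM2r => //; near: r; apply: nbhs_pinfty_ge; exact: num_real.
Unshelve. all: by end_near. Qed.

Variables (F : 'rV[R]_m -> R) (a : 'rV[R]_m -> {linear 'rV[R]_m -> R}).
Hypothesis dF : forall x v, is_derive x v F (a x v).

(** By the mean value theorem the increment of [F] from [x] to [x + v] is [a y v] for some [y] on
    the segment, and [a y] is close to [a x] uniformly in direction, since finitely many coordinates
    are continuous. *)
Lemma differentiable_of_derive : (forall v, continuous (fun x => a x v)) ->
  forall x, differentiable F x.
Proof.
move=> ca x; have ax : continuous (a x) by exact: linear_rV_continuous.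
have F_o : F \o shift x = cst (F x) + a x +o_ 0 id.
  apply/eqaddoP => _/posnumP[e].
  have near_a : \forall y \near x, forall v, `|a y v - a x v| <= e%:num * `|v|.
    (* The error is shared among the [m] coordinates; the denominator m+1 is positive even for [m] =
       0. *)
    have em : 0 < e%:num / m.+1%:R by rewrite divr_gt0.
    have : \forall y \near x, forall j : 'I_m,
        `|a y (delta_mx 0 j) - a x (delta_mx 0 j)| <= e%:num / m.+1%:R.
      apply: (filter_forall (F := nbhs x) (f := fun (j : 'I_m) y =>
        `|a y (delta_mx 0 j) - a x (delta_mx 0 j)| <= e%:num / m.+1%:R)) => j.
      have /cvgrPdist_le /(_ _ em) := ca (delta_mx 0 j) x.
      by apply: filterS => y; rewrite distrC.
    apply: filterS => y ay v.
    rewrite !linear_rVE -sumrB; apply: le_trans (ler_norm_sum _ _ _) _.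
    apply: le_trans (_ : \sum_(j < m) `|v| * (e%:num / m.+1%:R) <= _).
      apply: ler_sum => j _; rewrite -mulrBr normrM.
      by rewrite ler_pM // coord_le_norm.
    rewrite sumr_const card_ord -mulrnAr mulrC ler_wpM2r //.
    rewrite -[_ *+ m]mulr_natr -mulrA ler_piMr //.
    by rewrite mulrC ler_pdivrMr // mul1r ler_nat.
  have /nbhs_ballP[d /= d0 da] := near_a.
  have near_d : \forall v \near (0 : 'rV[R]_m), `|v| < d by exact: nbhs0_lt.
  near=> v.
  have vd : `|v| < d by near: v; exact: near_d.
  have dG y : derivable F y v by exact: ex_derive.
  have [c] := line_MVT x dG (@ler01 R).
  rewrite in_itv /= => /andP[c0 c1]; rewrite scale1r mul1r => Fv.
  rewrite !fctE /= /shift opprD addrA [v + x]addrC Fv.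
  rewrite (@derive_val _ _ _ _ _ _ _ (dF _ v)); apply: da.
  rewrite -ball_normE /= opprD addNKr normrN normrZ ger0_norm //.
  by apply: le_lt_trans vd; rewrite ler_piMl.
by apply/diff_locallyP; rewrite (diff_unique ax F_o).
Unshelve. all: by end_near. Qed.

Lemma smooth_of_derive :
  (forall v (s : seq 'rV[R]_m) x,
    differentiable (foldr (fun v g => 'D_v g) (fun y => a y v) s) x) ->
  forall (s : seq 'rV[R]_m) x, differentiable (foldr (fun v g => 'D_v g) F s) x.
Proof.
(* [foldr] applies the last direction of the list first; detaching it replaces [F] by a coefficient
   of [a]. *)
move=> sa s x; case/lastP: s => [|s v].
  apply: differentiable_of_derive => v y.
  by apply: differentiable_continuous; exact: (sa v [::]).
rewrite foldr_rcons (_ : 'D_v F = (fun y => a y v)) //.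
by apply/funext => y; rewrite (@derive_val _ _ _ _ _ _ _ (dF y v)).
Qed.

(* The periods of the closed 1-form dF are the c j. *)
Lemma periodic_correction :
  (forall x y, lattice_rel x y -> forall v, a x v = a y v) ->
  exists c : 'I_m -> R, forall x y, lattice_rel x y ->
    F x - \sum_j c j * x 0 j = F y - \sum_j c j * y 0 j.
Proof.
move=> pa; pose c j := F (delta_mx 0 j) - F 0; exists c.
pose G x := F x - \sum_j c j * x 0 j.
pose P z := forall x, G (x + z) = G x.
have Pe j : P (delta_mx 0 j).
  (* The increment [H] has zero derivative because [a] is periodic, so it equals its value [c j] at
     0. *)
  pose H x := F (x + delta_mx 0 j) - F x.
  have dH x v : is_derive x v H 0.
    have dFj : is_derive x v (fun y => F (y + delta_mx 0 j)) (a (x + delta_mx 0 j) v).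
      have e : (fun h : R => h^-1 *: (F (h *: v + x + delta_mx 0 j) - F (x + delta_mx 0 j)))
          = (fun h => h^-1 *: (F (h *: v + (x + delta_mx 0 j)) - F (x + delta_mx 0 j))).
        by apply/funext => h; rewrite addrA.
      by split; [rewrite /derivable /= e|rewrite /derive /= e]; case: (dF (x + delta_mx 0 j) v).
    rewrite (_ : 0 = a (x + delta_mx 0 j) v - a x v); first exact: is_deriveB.
    apply/esym/eqP; rewrite subr_eq0; apply/eqP; apply: pa; apply/forallP => i.
    by rewrite addrAC subrr add0r mxE eqxx; case: (i == j) => /=; rewrite ?rpred1 ?rpred0.
  have H0 x : H x = c j.
    have dHx y : derivable H y x by exact: ex_derive.
    have [t _] := line_MVT 0 dHx (@ler01 R).
    rewrite (@derive_val _ _ _ _ _ _ _ (dH _ x)) mulr0 scale1r add0r => /eqP.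
    by rewrite subr_eq0 => /eqP ->; rewrite /H add0r.
  move=> x; rewrite /G.
  have -> : \sum_i c i * (x + delta_mx 0 j) 0 i = \sum_i c i * x 0 i + c j.
    under eq_bigr => i _ do rewrite mxE mulrDr.
    rewrite big_split /=; congr (_ + _).
    rewrite (bigD1 j) //= big1 ?addr0 => [|i ij]; first by rewrite mxE !eqxx mulr1.
    by rewrite mxE eqxx (negbTE ij) mulr0.
  by rewrite -(H0 x) /H; ring.
(* The periods of [G] form a group containing the basis vectors, hence all of Z^m. *)
have PD z z' : P z -> P z' -> P (z + z').
  by move=> Pz Pz' x; rewrite addrA Pz' Pz.
have PN z : P z -> P (- z) by move=> Pz x; rewrite -[LHS](Pz (x - z)) subrK.
have P0 : P 0 by move=> x; rewrite addr0.
have PZ z (k : int) : P z -> P (z *~ k).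
  move=> Pz; have Pn i : P (z *+ i).
    by elim: i => [|i IH]; [rewrite mulr0n|rewrite mulrS; exact: PD].
  by case: k => i; [exact: Pn|rewrite NegzE mulrNz; exact/PN/Pn].
move=> x y /forallP xy; rewrite -/(G x) -/(G y).
have -> : x = y + (x - y) by rewrite addrCA subrr addr0.
rewrite (row_sum_delta (x - y)).
suff : P (\sum_j (x - y) 0 j *: delta_mx 0 j) by apply.
elim/big_ind: _ => // j _; have /intrP[k ->] := xy j.
by rewrite scaler_int; exact: PZ.
Qed.

End LinearForms.

(** * Exact forms with constant coefficients *)

Section Average.
Variables (R : realType) (m : nat).

Lemma on_cover_periodic (T : Type) (f : torus R m -> T) x y :
  lattice_rel x y -> on_cover f x = on_cover f y.
Proof. by move=> xy; congr f; apply/eqP; rewrite piE. Qed.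

Lemma norm_rV_le (v : 'rV[R]_m) r : 0 <= r -> (forall j, `|v 0 j| <= r) -> `|v| <= r.
Proof.
move=> r0 vr; rewrite [leLHS]/Num.Def.normr/= mx_normrE (bigmax_le _ r0) //= => -[i j] _ /=.
by rewrite [i]ord1.
Qed.

Section Grid.
Variable N : nat.
Local Notation grid := {ffun 'I_m -> 'I_N.+2}.

(** Representatives of the (N+2)-torsion points of the torus; ['I_N.+2] supplies the arithmetic
    modulo N+2. *)
Definition grid_pt (t : grid) : 'rV[R]_m := \row_j ((t j)%:R / N.+2%:R).

Definition grid_shift (j : 'I_m) (t : grid) : grid :=
  [ffun i => if i == j then t i + 1 else t i].

Lemma grid_shift_inj j : injective (grid_shift j).
Proof.
move=> t u /ffunP e; apply/ffunP => i; have := e i; rewrite !ffunE.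
by case: eqP => // _ /addIr.
Qed.

(** The two points differ in coordinate [j] by the carry of the addition modulo N+2, an integer. *)
Lemma grid_pt_shift j t : lattice_rel (grid_pt (grid_shift j t))
  (grid_pt t + N.+2%:R^-1 *: delta_mx 0 j).
Proof.
apply/forallP => i; rewrite !mxE eqxx /= ffunE.
have N0 : N.+2%:R != 0 :> R by rewrite pnatr_eq0.
case: eqP => [->|_]; last by rewrite mulr0 addr0 subrr rpred0.
have -> : (t j + 1)%R = ((t j).+1 %% N.+2)%N :> nat by rewrite /= modnDmr addn1.
have rE (x q r : nat) : x.+1 = (q * N.+2 + r)%N ->
    r%:R / N.+2%:R - (x%:R / N.+2%:R + N.+2%:R^-1 * 1) \is a @Num.int R.
  move=> e; have -> : r%:R = x%:R + 1 - q%:R * N.+2%:R :> R.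
    by rewrite natr1 e natrD natrM addrAC subrr add0r.
  rewrite (_ : _ - _ = - q%:R) ?rpredN ?natr_int //.
  have := N0; set z := (N.+2%:R : R) => z0; by field.
exact: rE (divn_eq _ _).
Qed.

End Grid.

(** Difference quotients of step 1/(N+2) sum to zero over the shift-invariant grid, and each differs
    from the derivative by at most M/(N+2), where [M] bounds the second derivative. *)
Lemma grid_sum_derive (g : torus R m -> R) j : smooth g -> exists M, forall N,
  `|\sum_(t : {ffun 'I_m -> 'I_N.+2}) 'D_(delta_mx 0 j) (on_cover g) (grid_pt t)|
  <= #|{ffun 'I_m -> 'I_N.+2}|%:R * (M / N.+2%:R).
Proof.
move=> sg; set e : 'rV[R]_m := delta_mx 0 j; pose G := on_cover g.
have dG x : derivable G x e by apply: diff_derivable; exact: (sg [::]).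
have dDG x : derivable ('D_e G) x e by apply: diff_derivable; exact: (sg [:: e]).
have cDDG : continuous ('D_e ('D_e G)).
  by move=> x; apply: differentiable_continuous; exact: (sg [:: e; e]).
(* In the maximum norm, grid points have norm at most 1 and the intermediate points lie within
   distance 1 of them. *)
have [M MP] := continuous_bounded_ball 2 cDDG.
exists M => N; have N0 : 0 < N.+2%:R :> R by rewrite ltr0n.
have -> : \sum_(t : {ffun 'I_m -> 'I_N.+2}) 'D_e G (grid_pt t) =
    \sum_(t : {ffun 'I_m -> 'I_N.+2}) ('D_e G (grid_pt t) -
      N.+2%:R * (G (grid_pt (grid_shift j t)) - G (grid_pt t))).
  rewrite sumrB -mulr_sumr sumrB [X in _ * (_ - X)](reindex_inj (@grid_shift_inj N j)).
  by rewrite subrr mulr0 subr0.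
apply: le_trans (ler_norm_sum _ _ _) _.
rewrite mulr_natl -sumr_const; apply: ler_sum => t _.
rewrite /G (on_cover_periodic g (grid_pt_shift j t)) -/G -/e.
have h0 : 0 <= N.+2%:R^-1 :> R by rewrite invr_ge0 (ltW N0).
have [c c01 ->] := line_MVT (grid_pt t) dG h0.
move: c01; rewrite in_itv /= => /andP[c0 c1].
(* A second mean value compares the derivative at [c] with that at the grid point. *)
have [c' c'c] := line_MVT (grid_pt t) dDG c0.
move: c'c; rewrite in_itv /= => /andP[c'0 c'1] ec.
rewrite mulrA mulfV ?gt_eqF // mul1r distrC ec normrM mulrC.
have h1 : N.+2%:R^-1 <= 1 :> R by rewrite invf_le1 // ler1n.
apply: ler_pM => //; last by rewrite ger0_norm.
apply: MP; apply: norm_rV_le => // i; rewrite !mxE.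
apply: le_trans (ler_normD _ _) _; rewrite -[leRHS]/(1 + 1 : R); apply: lerD.
  rewrite ger0_norm ?divr_ge0 // ler_pdivrMr // mul1r ler_nat.
  by rewrite ltnW.
rewrite normrM ger0_norm // -[leRHS]mulr1; apply: ler_pM => //.
  exact: le_trans c'1 (le_trans c1 h1).
by case: (_ && _); rewrite ?normr1 ?normr0.
Qed.

(* A divergence has mean zero, by Riemann sums over finite subgroups of the
   torus. *)
Lemma divergence_cst l (g : 'I_l -> torus R m -> R) (d : 'I_l -> 'I_m)
    (b : 'I_l -> R) c :
  (forall i, smooth (g i)) ->
  (forall x, \sum_i b i * 'D_(delta_mx 0 (d i)) (on_cover (g i)) x = c) -> c = 0.
Proof.
move=> sg gc.
have [M MP] := choice (fun i => grid_sum_derive (d i) (sg i)).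
pose K := \sum_i `|b i| * M i.
have cK N : `|c| * N.+2%:R <= K.
  pose T := {ffun 'I_m -> 'I_N.+2}.
  have T0 : 0 < #|T|%:R :> R.
    by rewrite ltr0n; apply/card_gt0P; exists [ffun=> 0].
  have N0 : 0 < N.+2%:R :> R by rewrite ltr0n.
  have : `|#|T|%:R * c| <= #|T|%:R * (K / N.+2%:R).
    have -> : #|T|%:R * c = \sum_(t : T) \sum_i
        b i * 'D_(delta_mx 0 (d i)) (on_cover (g i)) (grid_pt t).
      by rewrite mulr_natl -sumr_const; apply: eq_bigr => t _; rewrite gc.
    rewrite exchange_big /=; apply: le_trans (ler_norm_sum _ _ _) _.
    rewrite mulr_suml mulr_sumr; apply: ler_sum => i _.
    rewrite -mulr_sumr normrM -mulrA mulrCA ler_wpM2l //; exact: MP.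
  by rewrite normrM (ger0_norm (ltW T0)) ler_pM2l // ler_pdivlMr.
apply/eqP; apply: contraT => c0; have nc : 0 < `|c| by rewrite normr_gt0.
have K0 : 0 <= K by apply: le_trans (cK 0%N); rewrite mulr_ge0.
have := archi_boundP (divr_ge0 K0 (ltW nc)); set N := Num.bound _ => KN.
have := cK N; rewrite leNgt => /negP[]; rewrite mulrC -ltr_pdivrMr //.
by apply: lt_trans KN _; rewrite ltr_nat.
Qed.

End Average.

Section ConstantForms.
Variables (R : realType) (m : nat).

Definition basis_frame l (d : 'I_l -> 'I_m) : 'M[R]_(l, m) :=
  \matrix_(i, j) (j == d i)%:R.

Lemma row_basis_frame l (d : 'I_l -> 'I_m) i : row i (basis_frame d) = delta_mx 0 (d i).
Proof. by apply/rowP => j; rewrite !mxE. Qed.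

(** On a coordinate frame an exterior derivative is a signed sum of partial derivatives of functions
    on the torus, so [divergence_cst] applies. *)
Lemma exact_form_cst l (a : 'M[R]_(l, m) -> R) (d : 'I_l -> 'I_m) :
  exact_form ((fun=> a) : form R m l) -> a (basis_frame d) = 0.
Proof.
case: l a d => [a d /= /(congr1 (fun f : form R m 0 => f (\pi_(torus R m) 0) (basis_frame d)))//|].
move=> l a d [b [sb _ _] ab].
apply: (@divergence_cst R m l.+1 (fun i p => b p (row' i (basis_frame d))) d
  (fun i => (-1) ^+ i)) => [i|x]; first exact: sb.
have /= := congr1 (fun f : form R m l.+1 => f (\pi_(torus R m) x) (basis_frame d)) ab.
move=> ->; rewrite /extd; apply: eq_bigr => i _; congr (_ * _).
rewrite row_basis_frame.
exact: esym (congr1 (@^~ x) (on_cover_dder (delta_mx 0 (d i)) _)).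
Qed.

Lemma extd_cst l (a : form R m l) : (forall p q, a p = a q) -> extd a = 0.
Proof.
move=> ac; apply/funext => p; apply/funext => v; rewrite /extd big1 // => i _.
rewrite (_ : (fun q => a q (row' i v)) = fun=> a p (row' i v)).
  by rewrite dder_cst mulr0.
by apply/funext => q; rewrite (ac q p).
Qed.

Lemma is_form_cst l (a : 'M[R]_(l, m) -> R) :
  multilinear a -> alternating a -> is_form ((fun=> a) : form R m l).
Proof. by move=> ma aa; split=> // v; exact: smooth_cst. Qed.

(** The constant monomial dx_(d 0) /\ ... /\ dx_(d (l-1)). *)
Definition minor l (d : 'I_l -> 'I_m) (v : 'M[R]_(l, m)) : R :=
  \det (\matrix_(i, j) v i (d j)).

Lemma minor_multilinear l (d : 'I_l -> 'I_m) : multilinear (minor d).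
Proof.
move=> i c u w v; rewrite -[minor d (setrow i w v)]mul1r.
apply: (determinant_multilinear (i0 := i)).
- by apply/rowP => j; rewrite !mxE eqxx !mxE mul1r.
- by apply/matrixP => x y; rewrite !mxE eq_sym (negbTE (neq_lift _ _)).
- by apply/matrixP => x y; rewrite !mxE eq_sym (negbTE (neq_lift _ _)).
Qed.

Lemma minor_alternating l (d : 'I_l -> 'I_m) : alternating (minor d).
Proof.
move=> i j v ij /rowP e; apply: (determinant_alternate ij) => x.
by rewrite !mxE; have := e (d x); rewrite !mxE.
Qed.

End ConstantForms.

(** * Monomials as harmonic forms *)

Section HarmonicForms.
Variables (R : realType) (n : nat).

Lemma fhat_cst k (a : form R (n + n) k) : (forall p q, a p = a q) ->
  forall p q, fhat a p = fhat a q.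
Proof.
move=> ac; rewrite /fhat; elim/big_ind: _ => // [a1 a2 h1 h2 p q|i _ p q].
  by rewrite !fctE (h1 p q) (h2 p q).
have cc (j : 'I_(n + n)) k' (b : form R (n + n) k') : (forall p q, b p = b q) ->
    forall p q, contract (coordv j) b p = contract (coordv j) b q.
  case: k' b => // k' b bc p' q'; apply/funext => v /=.
  by rewrite /contract (bc p' q').
exact: (cc _ _ _ (cc _ _ _ ac)).
Qed.

Lemma fhat0 k : fhat (0 : form R (n + n) k) = 0.
Proof.
by have := fhat_lin (-1) (0 : form R (n + n) k) 0; rewrite scaler0 addr0 scaleN1r addNr.
Qed.

Lemma codiff_cst k (a : form R (n + n) k) : (forall p q, a p = a q) -> codiff a = 0.
Proof.
case: k a => [|[|k]] a ac; rewrite /codiff extd_cst // fhat0 // extd_cst ?subrr //.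
exact: fhat_cst.
Qed.

(** Subsets, rather than index sequences, count each monomial once up to sign. *)
Definition minor_index k := {S : {set 'I_(n + n)} | #|S| == k}.

Definition minor_enum k (S : minor_index k) (i : 'I_k) : 'I_(n + n) :=
  enum_val (cast_ord (esym (eqP (valP S))) i).

Lemma minor_enum_inj k (S : minor_index k) : injective (minor_enum S).
Proof. by move=> i j /enum_val_inj /cast_ord_inj. Qed.

(** For S = T the matrix is the identity. Otherwise, the sizes being equal, some element of T lies
    outside S, and its row is zero. *)
Lemma minor_basis k (S T : minor_index k) :
  minor (minor_enum S) (basis_frame R (minor_enum T)) = (S == T)%:R.
Proof.
have [->|ST] := eqVneq S T.
  rewrite /minor (_ : \matrix_(i, j) _ = 1%:M) ?det1 //.
  by apply/matrixP => i j; rewrite !mxE (inj_eq (@minor_enum_inj _ T)) eq_sym.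
have [x xT xS] : exists2 x, x \in val T & x \notin val S.
  apply/subsetPn; apply: contra ST => TS; rewrite -val_eqE eq_sym eqEcard TS.
  by rewrite (eqP (valP S)) (eqP (valP T)) leqnn.
pose i : 'I_k := cast_ord (eqP (valP T)) (enum_rank_in xT x).
have ix : minor_enum T i = x.
  rewrite /minor_enum (_ : cast_ord _ i = enum_rank_in xT x); last exact/val_inj.
  by rewrite enum_rankK_in.
rewrite /minor (expand_det_row _ i) big1 // => j _; rewrite !mxE ix.
rewrite (_ : (_ == x) = false) ?mul0r //.
by apply/negbTE; apply: contra xS => /eqP <-; exact: enum_valP.
Qed.

Fact minor_harmonic k (S : minor_index k) :
  ((fun=> minor (minor_enum S)) : form R (n + n) k) \in
    subspace_pred (harmonic_forms R n k).
Proof.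
apply/asboolP; split.
- by apply: is_form_cst; [exact: minor_multilinear|exact: minor_alternating].
- exact: extd_cst.
- exact: codiff_cst.
Qed.

Definition minor_class k (S : minor_index k) : H_hr R n k :=
  lquot_pi _ (SubspaceType (minor_harmonic S)).

End HarmonicForms.

(** * Comparison of the cohomology spaces *)

Section LinearQuotientSums.
Variables (K : pzRingType) (V : lmodType K) (S : subspace V).

Lemma lquot_pi0 : lquot_pi S 0 = 0.
Proof. by apply: (addIr (lquot_pi S 0)); rewrite -lquot_piD addr0 add0r. Qed.

Lemma lquot_pi_lincomb (I : finType) (r : I -> K) (x : I -> V) :
  \sum_i r i *: lquot_pi S (x i) = lquot_pi S (\sum_i r i *: x i).
Proof.
rewrite (big_morph (lquot_pi S) (@lquot_piD _ _ S) lquot_pi0).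
by apply: eq_bigr => i _; rewrite lquot_piZ.
Qed.

End LinearQuotientSums.

Lemma subspace_val_lincomb (K : pzRingType) (V : lmodType K) (S : subspace V)
    (I : finType) (r : I -> K) (x : I -> subspace_type S) :
  subspace_val (\sum_i r i *: x i) = \sum_i r i *: subspace_val (x i).
Proof.
have vP a (y z : subspace_type S) :
    subspace_val (a *: y + z) = a *: subspace_val y + subspace_val z.
  by rewrite -[LHS]/(\val (a *: y + z)) linearP.
have v0 : subspace_val (0 : subspace_type S) = 0.
  by have := vP (-1) 0 0; rewrite scaler0 addr0 scaleN1r addNr.
apply: (big_ind2 (fun y z => subspace_val y = z)); first exact: v0.
  by move=> y1 z1 y2 z2 <- <-; rewrite -{1}[y1]scale1r vP scale1r.
by move=> i _; have := vP (r i) (x i) 0; rewrite v0 !addr0.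
Qed.

Section HarmonicBound.
Variables (R : realType) (n : nat).

(** A relation among the classes is an exact constant form; evaluating it on the frame of [S]
    isolates [r S]. *)
Lemma minor_class_free k (r : minor_index n k -> R) :
  \sum_S r S *: minor_class R S = 0 -> forall S, r S = 0.
Proof.
move=> r0 S; move: r0; rewrite /minor_class.
rewrite (lquot_pi_lincomb _ r (fun S => SubspaceType (minor_harmonic R S))).
rewrite -lquot_pi0 => /lquot_piE; rewrite subr0 => /asboolP.
rewrite subspace_val_lincomb /=.
pose a (v : 'M[R]_(k, n + n)) := \sum_T r T * minor (minor_enum T) v.
have -> : \sum_T r T *: ((fun=> minor (minor_enum T)) : form R (n + n) k) = fun=> a.
  apply/funext => p; apply/funext => v.
  by rewrite (big_morph (fun b : form R (n + n) k => b p v) (id1 := 0) (op1 := +%R)).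
move/(@exact_form_cst _ _ _ _ (minor_enum S)); rewrite /a (bigD1 S) //= big1.
  by rewrite minor_basis eqxx mulr1 addr0.
by move=> T TS; rewrite minor_basis (negbTE TS) mulr0.
Qed.

Lemma card_minor_index k : #|{: minor_index n k}| = 'C(n + n, k).
Proof.
have := card_draws 'I_(n + n) k; rewrite card_ord => <-; rewrite card_sig.
by apply: eq_card => S; rewrite !inE.
Qed.

End HarmonicBound.

(** Induction by Pascal's rule, with the extreme cases l = 2 and l = m - 2 exchanged by symmetry. *)
Lemma bin_gt m l : (1 < l)%N -> (l.+1 < m)%N -> (3 < m)%N -> (m < 'C(m, l))%N.
Proof.
elim: m l => [//|m IH] l l1 lm m3.
have base : (m.+1 < 'C(m.+1, 2))%N.
  by rewrite bin2 -divn2 leq_divRL //; nia.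
have [->//|l2] := eqVneq l 2%N.
have [lm2|lm2] := eqVneq l.+2 m.+1.
  by rewrite -bin_sub; [have -> : (m.+1 - l = 2)%N by lia|lia].
case: l l1 lm l2 lm2 => // l l1 lm l2 lm2; rewrite binS.
have h : (m < 'C(m, l.+1))%N by apply: IH; lia.
have : (0 < 'C(m, l))%N by rewrite bin_gt0; lia.
by lia.
Qed.

Section SmoothLinear.
Variables (R : realType) (m : nat).

Lemma derive_linear (L : {linear 'rV[R]_m -> R}) (f : 'rV[R]_m -> 'rV[R]_m) x v :
  differentiable f x -> 'D_v (L \o f) x = L ('D_v f x).
Proof.
move=> df; have dL y : differentiable L y.
  by apply: linear_differentiable; exact: linear_rV_continuous.
rewrite !deriveE //; last exact: differentiable_comp.
by rewrite diff_comp //= diff_lin //; exact: linear_rV_continuous.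
Qed.

Lemma smooth_linear (L : {linear 'rV[R]_m -> R}) (X : vfield R m) :
  smooth X -> smooth (L \o X).
Proof.
move=> sX s x.
have -> : foldr (fun v g => 'D_v g) (on_cover (L \o X)) s =
    L \o foldr (fun v g => 'D_v g) (on_cover X) s.
  elim: s => [//|v s /= ->]; apply/funext => y.
  by rewrite derive_linear //; exact: sX.
apply: differentiable_comp; first exact: sX.
by apply: linear_differentiable; exact: linear_rV_continuous.
Qed.

Lemma linear_basis0 (f : 'rV[R]_m -> R) :
  (forall c u w, f (c *: u + w) = c * f u + f w) ->
  (forall j, f (delta_mx 0 j) = 0) -> forall v, f v = 0.
Proof.
move=> fl f0 v.
have f00 : f 0 = 0 by rewrite -[0](addr0) -[X in X + _](scaler0 _ (-1)) fl; ring.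
rewrite (row_sum_delta v); elim/big_ind: _ => // [u w fu fw|j _].
  by rewrite -[u]scale1r fl fu fw mulr0 addr0.
by rewrite -[_ *: _]addr0 fl f0 f00 mulr0 addr0.
Qed.

Lemma multilinear0 l (a : 'M[R]_(l, m) -> R) i v : multilinear a -> a (setrow i 0 v) = 0.
Proof.
move=> /(_ i (-1) 0 0 v); rewrite scaler0 addr0 => e.
by rewrite e; ring.
Qed.

Lemma multilinearN l (a : 'M[R]_(l, m) -> R) i u v : multilinear a ->
  a (setrow i (- u) v) = - a (setrow i u v).
Proof.
move=> ma; have := ma i (-1) u 0 v.
by rewrite scaleN1r addr0 multilinear0 // addr0 mulN1r.
Qed.

End SmoothLinear.

(** * Symplectic fields modulo Hamiltonian ones *)

Section SymplecticFields.
Variables (R : realType) (n : nat).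
Local Notation V := 'rV[R]_(n + n).

Fact sympl_linear (u : V) : linear (sympl u : V -> R).
Proof. by move=> c w w'; rewrite sympl_linr. Qed.
HB.instance Definition _ (u : V) :=
  GRing.isLinear.Build R V R _ (sympl u) (sympl_linear u).

(** Nondegeneracy of [omega]; it turns the linear form of periods into a constant field. *)
Lemma sympl_repr (c : 'I_(n + n) -> R) :
  exists xi : V, forall v, sympl xi v = \sum_j c j * v 0 j.
Proof.
exists (\row_j match fintype.split j with
  | inl i => c (rshift n i) | inr i => - c (lshift n i) end) => v.
rewrite big_split_ord /= -big_split; apply: eq_bigr => i _ /=.
by rewrite !mxE (unsplitK (inl i)) (unsplitK (inr i)) /=; ring.
Qed.

Lemma smooth_sympl (X : vfield R (n + n)) v :
  smooth X -> smooth (fun p => sympl (X p) v).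
Proof.
move=> sX.
rewrite (_ : (fun p => _) = -1 *: (sympl v \o X) + fun=> 0).
  by apply: smooth_lin; [exact: smooth_linear|exact: smooth_cst].
by apply/funext => p; rewrite !fctE /= addr0 scaleN1r -symplC.
Qed.

Lemma derive_sympl (f : V -> V) x u v : differentiable f x ->
  'D_u (fun y => sympl (f y) v) x = sympl ('D_u f x) v.
Proof.
move=> df; have -> : (fun y => sympl (f y) v) = - (sympl v \o f).
  by apply/funext => y; rewrite symplC.
rewrite deriveN ?derive_linear -?symplC //.
apply: diff_derivable; apply: differentiable_comp => //.
by apply: linear_differentiable; exact: linear_rV_continuous.
Qed.

Lemma cst_symplectic k (xi : V) : (fun=> xi) \in subspace_pred (X_S R n k).
Proof.
apply/asboolP; split; first exact: smooth_cst.
apply/funext => p; apply/funext => v; rewrite /lie_derivative.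
have [ml ct] := omegaP R n.
rewrite (_ : (fun q => wpow _ k q v) = fun=> wpow (@omega R n) k p v); last first.
  by apply/funext => q; rewrite (wpow_cst k ct q p).
rewrite dder_cst big1 ?subr0 // => i _.
by rewrite /lie_bracket !dder_cst subr0 multilinear0 //; exact: wpow_multilinear.
Qed.

(** The expression is d(i_X omega) on (u, w). On constant fields L_X omega^(k+1) is the action
    [wpow_der] of the derivative of [X], and [wpow_der_inj] cancels the factor omega^k. *)
Lemma symplectic_field_closed k (X : vfield R (n + n)) : (k.+1 < n)%N ->
  X \in subspace_pred (X_S R n k.+1) ->
  forall x u w, sympl ('D_u (on_cover X) x) w + sympl u ('D_w (on_cover X) x) = 0.
Proof.
move=> kn /asboolP[sX LX] x; pose A u := 'D_u (on_cover X) x.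
have dX : differentiable (on_cover X) x by exact: (sX [::]).
have Al c u w : A (c *: u + w) = c *: A u + A w.
  by rewrite /A !deriveE // linearP.
pose p := \pi_(torus R (n + n)) x.
have [ml ct] := omegaP R n.
have T0 v : wpow_der (@omega R n) p A (k := k.+1) v = 0.
  have := congr1 (fun a : form R (n + n) k.+1.*2 => a p v) LX.
  rewrite /lie_derivative.
  rewrite (_ : (fun q => wpow _ k.+1 q v) = fun=> wpow (@omega R n) k.+1 p v); last first.
    by apply/funext => q; rewrite (wpow_cst k.+1 ct q p).
  rewrite dder_cst => /eqP.
  rewrite -[X in X == _]/(0 - _ : R) sub0r oppr_eq0 => /eqP s0.
  apply/eqP; rewrite -oppr_eq0; apply/eqP; rewrite -[RHS]s0 /wpow_der -sumrN.
  apply: eq_bigr => i _; rewrite -multilinearN; last exact: wpow_multilinear.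
  congr (wpow _ _ p (setrow i _ v)).
  (* The bracket of [X] with a constant field is minus the derivative of [X] along it. *)
  rewrite /lie_bracket dder_cst sub0r; congr (- _).
  exact: esym (congr1 (@^~ x) (on_cover_dder (row i v) X)).
have B0 := wpow_der_inj kn T0.
move=> u w; rewrite -/(der2 (@sympl R n) A u w).
have Bl z c y y' : der2 (@sympl R n) A z (c *: y + y') =
    c * der2 (@sympl R n) A z y + der2 (@sympl R n) A z y'.
  by rewrite /der2 Al !sympl_linr mulrDr addrACA.
apply: (linear_basis0 (Bl u)) => j.
rewrite (der2C (@symplC R n)); apply/eqP; rewrite oppr_eq0; apply/eqP.
by apply: (linear_basis0 (Bl _)) => i; exact: B0.
Qed.

(** Here i_X omega^(k+1) = (k+1) df /\ omega^k = d((k+1) f omega^k), as omega^k has constant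
    coefficients. *)
Lemma hamiltonian_of_potential k (X : vfield R (n + n)) (f : torus R (n + n) -> R) :
  smooth X -> smooth f ->
  (forall p v, dder (fun=> v) f p = sympl (X p) v) ->
  X \in subspace_pred (X_H R n k.+1).
Proof.
move=> sX sf df; apply/asboolP; split=> //=.
have [ml ct] := omegaP R n.
(* The minus sign of the witness is that of -i_X in [hamiltonian_pred]. *)
exists (fun p v => f p * (- k.+1%:R * wpow (@omega R n) k p v)).
  split.
  - move=> v; rewrite (_ : (fun p => _) =
        (- k.+1%:R * wpow (@omega R n) k (\pi_(torus R (n + n)) 0) v) *: f + fun=> 0).
      by apply: smooth_lin => //; exact: smooth_cst.
    apply/funext => p; rewrite !fctE addr0 (wpow_cst k ct _ p).
    by rewrite [RHS]/GRing.scale /= mulrC.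
  - by move=> p i c u w v; rewrite (wpow_multilinear (k := k) (ml p)); ring.
  - move=> p i j v ij e.
    by rewrite (wpow_alternating (omegaE p) ij e) !mulr0.
apply/funext => p; apply/funext => v.
rewrite -[LHS]/(- wpow (@omega R n) k.+1 p (col_mx (X p) v : 'M[R]_(1 + k.*2.+1, n + n))).
rewrite (wpow_expand (@symplC R n) (omegaE p)) -mulNr mulr_sumr.
rewrite /extd; apply: eq_bigr => j _; rewrite mulrCA; congr (_ * _).
set w := wpow (@omega R n) k p (row' j v).
rewrite (_ : (fun q => _) = (- k.+1%:R * w) *: f + fun=> 0); last first.
  apply/funext => q; rewrite !fctE addr0 (wpow_cst k ct q p) -/w.
  by rewrite [RHS]/GRing.scale /= mulrC.
rewrite dder_lin //; last exact: smooth_cst.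
rewrite dder_cst addr0 -[RHS]/(- k.+1%:R * w * dder (fun=> row j v) f p) df.
by ring.
Qed.

Lemma symplectic_field_cst k (X : vfield R (n + n)) : (k.+1 < n)%N ->
  X \in subspace_pred (X_S R n k.+1) ->
  exists xi : V, X - (fun=> xi) \in subspace_pred (X_H R n k.+1).
Proof.
move=> kn XS; have cX := symplectic_field_closed kn XS.
have sX : smooth X by case/asboolP: XS.
pose a x : {linear V -> R} := sympl (on_cover X x).
have sa v : smooth (fun p => sympl (X p) v) by exact: smooth_sympl.
have da v x : differentiable (fun x => a x v) x by exact: (sa v [::]).
have ca u v : continuous ('D_u (fun x => a x v)).
  by move=> x; apply: differentiable_continuous; exact: (sa v [:: u]).
have cl u v x : 'D_u (fun x => a x v) x = 'D_v (fun x => a x u) x.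
  rewrite !derive_sympl; [|exact: (sX [::])..].
  apply/eqP; rewrite [sympl ('D_v _ _) u]symplC -addr_eq0; apply/eqP; exact: cX.
have dF := derive_primitive da ca cl.
have pa x y : lattice_rel x y -> forall v, a x v = a y v.
  by move=> xy v; rewrite /a (on_cover_periodic X xy).
have [c cP] := periodic_correction dF pa.
(* Contracting [omega] with [xi] gives the linear form with the periods [c] as coefficients. *)
have [xi xiP] := sympl_repr c; exists xi.
pose G x := primitive a x - sympl xi x.
(* [f] reads [G] at a chosen representative; periodicity of [G] makes the choice immaterial. *)
pose f : torus R (n + n) -> R := fun p => G (repr p).
have fG : on_cover f = G.
  apply/funext => x; rewrite /on_cover /f /G !xiP; apply: cP.
  by have /eqP := reprK (\pi_(torus R (n + n)) x); rewrite piE.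
pose Y : vfield R (n + n) := X - (fun=> xi).
have sY : smooth Y.
  rewrite /Y (_ : X - _ = -1 *: (fun=> xi) + X); last by rewrite scaleN1r addrC.
  by apply: smooth_lin => //; exact: smooth_cst.
(* [b] is i_Y omega on the cover. It turns out to be dG, so smoothness of [f] follows from that of
   [Y]. *)
pose b x : {linear V -> R} := sympl (on_cover Y x).
have dG x v : is_derive x v G (b x v).
  have dxi : is_derive x v (sympl xi) (sympl xi v).
    have dd : differentiable (sympl xi) x.
      by apply: linear_differentiable; exact: linear_rV_continuous.
    split; first exact: diff_derivable.
    by rewrite deriveE // diff_lin //; exact: linear_rV_continuous.
  rewrite (_ : b x v = a x v - sympl xi v); first exact: is_deriveB.
  have e : on_cover Y x = -1 *: xi + on_cover X x by rewrite scaleN1r addrC.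
  rewrite /b e; apply: etrans (sympl_linl (-1) xi (on_cover X x) v) _.
  by rewrite mulN1r addrC.
apply: (@hamiltonian_of_potential k Y f) => //.
- move=> s x; rewrite fG; apply: (smooth_of_derive dG) => v s' y.
  exact: (smooth_sympl v sY).
- move=> p v; rewrite /dder fG (@derive_val _ _ _ _ _ _ _ (dG _ v)) /b.
  by rewrite /on_cover reprK.
Qed.

Definition cst_class k (xi : V) : H_EL R n k :=
  lquot_pi _ (SubspaceType (cst_symplectic k xi)).

Lemma cst_class_surj k : (k.+1 < n)%N -> forall h : H_EL R n k.+1,
  exists xi, h = cst_class k.+1 xi.
Proof.
move=> kn; apply: lquot_ind => -[X XS].
have [xi xiP] := symplectic_field_cst kn XS; exists xi.
apply/lquot_piE; rewrite -[_ \in _]/(subspace_val _ \in subspace_pred (X_H R n k.+1)).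
have -> : subspace_val (SubspaceType XS - SubspaceType (cst_symplectic k.+1 xi)) =
    X - (fun=> xi) by rewrite -[LHS]/(\val (_ - _)) linearB.
exact: xiP.
Qed.

(** More than 2n vectors of R^(2n) are dependent, already before passing to classes. *)
Lemma cst_class_dependent k (I : finType) (c : I -> V) : (n + n < #|I|)%N ->
  exists2 r : I -> R, exists i, r i != 0 & \sum_i r i *: cst_class k (c i) = 0.
Proof.
move=> nI; pose C : 'M[R]_(#|I|, n + n) := \matrix_i c (enum_val i).
have : kermx C != 0.
  rewrite kermx_eq0 /row_free neq_ltn; apply/orP; left.
  exact: leq_ltn_trans (rank_leq_col C) nI.
case/rowV0Pn => r /sub_kermxP rC r0.
exists (fun i => r 0 (enum_rank i)).
  have /rV0Pn[j rj] := r0; exists (enum_val j); by rewrite enum_valK.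
rewrite /cst_class (lquot_pi_lincomb _ _ (fun i => SubspaceType (cst_symplectic k (c i)))).
rewrite (_ : \sum_i _ = 0) ?lquot_pi0 //; apply/val_inj.
rewrite -[LHS]/(subspace_val _) subspace_val_lincomb raddf0 /=.
apply/funext => p.
rewrite (big_morph (fun b : vfield R (n + n) => b p) (id1 := 0) (op1 := +%R)) //=.
rewrite -[RHS]rC mulmx_sum_row.
rewrite (reindex (@enum_val I I)) /=; last first.
  by exists enum_rank => i _; rewrite ?enum_valK ?enum_rankK.
by apply: eq_bigr => i _; rewrite enum_valK rowK.
Qed.

End SymplecticFields.

Theorem theorem7 (R : realType) (n k : nat) (k_gt1 : (1 < k)%N) (k_lt_n : (k < n)%N) :
  ~ lin_isomorphic (H_EL R n k) (H_hr R n k.*2.-1).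
Proof.
case: k k_gt1 k_lt_n => // k k_gt1 k_lt_n [f [g fK gK]].
pose I := minor_index n k.+1.*2.-1.
(* The inverse [g] sends each monomial class to the class of a constant field [c S]. *)
have [c cP] := choice (fun S : I => cst_class_surj k_lt_n (g (minor_class R S))).
have nI : (n + n < #|{: I}|)%N by rewrite card_minor_index; apply: bin_gt; lia.
(* As there are more than 2n monomials, these classes satisfy a nontrivial relation, which [f]
   carries to the independent monomial classes. *)
have [r [S rS] r0] := cst_class_dependent k.+1 c nI.
move: rS; rewrite (minor_class_free (r := r)) ?eqxx //.
rewrite -[RHS](raddf0 f) -r0 raddf_sum; apply: eq_bigr => T _.
have fZ (a : R) x : f (a *: x) = a *: f x by exact: linearZ_LR.
by rewrite [RHS]fZ -cP gK.
Qed.
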